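(* Let $d\ge 1$ and suppose that balls, annuli and the sets $E_\mu(\delta,\eta)$ are defined with the norm $\|x\|_\infty=\max\{|x_i|: i=1,\dots,d\}$ on $\mathbb{R}^d$. For all real numbers $\underline{d},\overline{d}$ with $d-1<\underline{d}<\overline{d}<d$ and every $\eta\in(0,1)$, there exists a (Radon) probability measure $\mu$ on $\mathbb{R}^{d}$ such that $\underline{\dim}(\mu) = \underline{d}$, $\overline{\dim}(\mu) =\overline{d}$ and $$\mu\left(E_\mu\left( \frac{\overline{d}-(d-1)}{\underline{d}-(d-1)},\ \eta\right)\right) =1.$$
   Context: For the norm $\|\cdot\|=\|\cdot\|_\infty$, $B(x,r)=\{y\in\mathbb{R}^d:\|x-y\|\le r\}$ is the closed ball. For $x\in \mathbb{R}^d$, $0<r<1$ and $\delta \geq 1$, the annulus is $A(x,r,\delta) = B (x,r)\setminus B (x,r-r^\delta)$. One says that $P_{\mu}(x,r,\delta,\eta)$ holds when $\mu(A (x,r,\delta)) \geq \eta\, \mu(B(x,r))$. One sets $E_{\mu}(\delta,\eta) = \{x\in \mathbb{R}^d: P_{\mu}(x,r_n,\delta,\eta)$ holds for every $n$, for some sequence of radii $(r_n)_{n\geq 1}$ tending to $0\}$. The lower and upper dimensions of $\mu$ are $\underline{\dim}(\mu)= \sup \{\alpha\geq 0: \text{ for } \mu\text{-a.e. } x,\ \exists\, r_x>0,\ \forall\, 0<r<r_x,\ \mu(B(x,r)) \leq r^\alpha\}$ and $\overline{\dim}(\mu)= \inf \{\beta\geq 0: \text{ for } \mu\text{-a.e.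 } x,\ \exists\, r_x>0,\ \forall\, 0<r<r_x,\ \mu(B(x,r)) \geq r^\beta\}$. *)

(* Defs.v *)
From HB Require Import structures.
From mathcomp Require Import all_boot all_order all_algebra.
From mathcomp Require Import all_classical all_reals all_analysis.

Set Implicit Arguments.
Unset Strict Implicit.
Unset Printing Implicit Defensive.

Import Order.TTheory GRing.Theory Num.Theory.
Import numFieldNormedType.Exports.

Local Open Scope classical_set_scope.
Local Open Scope ring_scope.

(* R^d with its Borel sigma-algebra. The library's norm on ['rV[R]_d] is the
   sup norm, see [mx_normrE]. *)
Notation borel_rV R d :=
  (g_sigma_algebraType (@open 'rV[R]_d)) (only parsing).

(* [mu K] makes sense for [K] compact, since such a [K] is closed. *)
Definition radon (R : realType) (d : nat)
    (mu : {measure set (borel_rV R d) -> \bar R}) : Prop :=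
  (forall K : set 'rV[R]_d, compact K -> (mu K < +oo)%E) /\
  (forall A : set (borel_rV R d), measurable A ->
     mu A = ereal_sup
       [set mu K | K in [set K : set 'rV[R]_d | compact K /\ K `<=` A]]).

(* The library's [closed_ball] is the closure of the open ball, hence empty for
   radius 0; [closed_ball_] is literally {y | |x - y| <= r}. *)
Definition cball (R : realType) (d : nat) (x : 'rV[R]_d) (r : R) :
    set 'rV[R]_d :=
  closed_ball_ Num.norm x r.

Definition annulus (R : realType) (d : nat) (x : 'rV[R]_d) (r delta : R) :
    set 'rV[R]_d :=
  cball x r `\` cball x (r - r `^ delta).

Section measure_on_Rd.
Context {R : realType} {d : nat}.
Variable mu : {measure set (borel_rV R d) -> \bar R}.

Definition annulus_prop (x : 'rV[R]_d) (r delta eta : R) : Prop :=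
  (eta%:E * mu (cball x r) <= mu (annulus x r delta))%E.

(* The radii lie in ]0, 1[, the range on which annuli are considered. *)
Definition annulus_set (delta eta : R) : set 'rV[R]_d :=
  [set x | exists r : nat -> R,
    [/\ forall n, 0 < r n < 1,
        r @ \oo --> (0 : R) &
        forall n, annulus_prop x (r n) delta eta]].

(* Both dimensions are taken in [\bar R], so that the infimum of the empty set
   is +oo. *)
Definition lower_dim : \bar R :=
  ereal_sup [set alpha%:E | alpha in [set alpha : R | 0 <= alpha /\
    {ae mu, forall x, exists2 rx : R, 0 < rx &
      forall r : R, 0 < r < rx -> (mu (cball x r) <= (r `^ alpha)%:E)%E}]].

Definition upper_dim : \bar R :=
  ereal_inf [set beta%:E | beta in [set beta : R | 0 <= beta /\
    {ae mu, forall x, exists2 rx : R, 0 < rx &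
      forall r : R, 0 < r < rx -> ((r `^ beta)%:E <= mu (cball x r))%E}]].

End measure_on_Rd.

(* Main.v *)
Require Import Defs.
From HB Require Import structures.
From mathcomp Require Import all_boot all_order all_algebra.
From mathcomp Require Import all_classical all_reals all_analysis.
From mathcomp Require Import measurable_realfun.
From mathcomp Require Import ring lra.
Set Implicit Arguments.
Unset Strict Implicit.
Unset Printing Implicit Defensive.
Import Order.TTheory GRing.Theory Num.Theory.
Import numFieldNormedType.Exports.
Local Open Scope classical_set_scope.
Local Open Scope ring_scope.

(** Write d - 1 = k, s = dl - k and t = du - k, so that 0 < s < t < 1 and
delta = t / s. The measure is the product of a probability nu on R and of k
copies of the uniform law on [0,1]. A cube of R^d is a product of intervals, so
its mass is the mass of an interval for nu times a quantity comparable with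
r ^ k. Moreover the annulus of centre x for the sup norm contains all the points
of the cube whose first coordinate lies in the corresponding one-dimensional
annulus. It is thus enough to find nu on the line with dimensions s and t for
which infinitely many intervals around almost every point have a share at least
eta of their mass in the two end parts of length r ^ delta.

The measure nu is carried by a Cantor set built as follows. A piece of
generation n, an interval of length w_n, is cut into N_n cells of length
r_n = w_n / N_n. In each cell live M pieces of generation n + 1, all of the same
mass: one at the left end, of digit 0, and M - 1 consecutive ones that end at one
third of the cell. These pieces are so short that the last M - 1 of them together
have length at most (r_n / 4) ^ delta. Seen from a point of the isolated piece,
the cell is an interval of radius about r_n / 3 in which all the mass except a
share 1 / M sits at distance at most (radius) ^ delta from the right end point;
the last two thirds of every cell are empty, so that nothing else is in sight
([zero_digit_annulus]). The digit 0 has probability 1 / M, independently in each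
generation, so almost every point has infinitely many digits 0
([nu_zero_digit_often]).

Let Q_n be the number of pieces of generation n, and D_n = Q_n N_n the number of
cells. The number N_n of cells is chosen so that a cell, of mass 1 / D_n, has
mass comparable with r_n ^ t; as w_(n+1) is comparable with r_n ^ delta and
delta s = t, a piece of generation n + 1 then has mass comparable with
w_(n+1) ^ s ([scheme_exists]). The dimension seen at the scale r is thus t for
r = r_n and s for r = w_n, and it lies in between at all other scales because nu
is spread evenly over the cells of a piece ([nu_upper], [nu_lower]). The constants
in these comparisons do not depend on n.

The measure nu is the law of [coding om] for a uniform om in [0,1], where
[coding] sends the mixed radix digits of om to the corresponding point of the
Cantor set. The map expands and contracts intervals in a controlled way
([coding_expand], [coding_contract]), which turns the geometry into estimates of
the masses.

Inner regularity holds for every Borel probability on R^d that has a compact set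
of full measure ([radon_of_compact_support]). The set of the theorem is defined
by an uncountable union over the radii; it is a Borel set since the mass of a cube
depends continuously on the radius, nu being without atoms, so that a maximum
over the radii can be tested on rational ones ([measurable_annulus_set]). *)

(** * Geometry of the Cantor scheme *)

(** Passing from the integer part of k x to that of x is dropping the last digit;
the case x < 0 holds because [Num.truncn] is 0 there. *)
Lemma truncn_mulr_divn (R : realType) (x : R) (k : nat) : (0 < k)%N ->
  (Num.truncn (x * k%:R) %/ k)%N = Num.truncn x.
Proof.
move=> k0; have [x0|x0] := leP 0 x; last first.
  have z (y : R) : y < 0 -> Num.truncn y = 0%N.
    by move=> y0; apply/truncn0Pn; rewrite -ltNge (lt_trans y0).
  by rewrite !z ?div0n// pmulr_llt0// ltr0n.
have xk0 : 0 <= x * k%:R by rewrite mulr_ge0.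
apply/eqP; rewrite eq_sym truncn_eq//; apply/andP; split.
  rewrite -(ler_pM2r (_ : 0 < k%:R)) ?ltr0n// -natrM.
  apply: le_trans (_ : (Num.truncn (x * k%:R))%:R <= _); last by rewrite truncn_le.
  by rewrite ler_nat leq_divM.
rewrite -(ltr_pM2r (_ : 0 < k%:R)) ?ltr0n// -natrM.
by rewrite -truncn_lt_nat// ltn_ceil.
Qed.

Lemma step_le_add (R : realType) (f : nat -> R) (w : R) (m n : nat) :
  (forall k, f k + w <= f k.+1) -> (m <= n)%N ->
  f m + (n - m)%:R * w <= f n.
Proof.
move=> fw; elim: n => [|n ih]; first by rewrite leqn0 => /eqP->;
    rewrite subnn mul0r addr0.
rewrite leq_eqVlt => /orP[/eqP->|]; first by rewrite subnn mul0r addr0.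
rewrite ltnS => mn; apply: le_trans (fw n).
by rewrite subSn// -addn1 natrD mulrDl mul1r addrA lerD2r ih.
Qed.

Lemma step_lt_le (R : realType) (f : nat -> R) (w : R) (m n : nat) :
  0 <= w -> (forall k, f k + w <= f k.+1) -> (m < n)%N -> f m + w <= f n.
Proof.
move=> w0 fw mn; apply: le_trans (step_le_add fw (ltnW mn)).
by rewrite lerD2l ler_peMl// ler1n subn_gt0.
Qed.

Section scheme.
Context {R : realType}.
Variables (M : nat) (N : nat -> nat) (w : nat -> R).

Definition cellw n : R := w n / (N n)%:R.

Fixpoint pieces n : nat :=
  if n is n'.+1 then (pieces n' * N n' * M)%N else 1%N.

Definition cells n : nat := (pieces n * N n)%N.

(** Position in its cell of the piece of digit i: the digit 0 is alone at the left
end, the digits 1, ..., M - 1 fill an interval that ends at one third of the cell. *)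
Definition digit_off n (i : nat) : R :=
  if i == 0%N then 0 else cellw n / 3 - (M - i)%:R * w n.+1.

(** Left end of the k-th piece of generation n. The index k ranges over all natural
numbers: generation 0 is the tiling of the half-line by intervals of length w_0,
and the measure only charges the piece 0 of that generation. This way no bound on
the indices has to be carried along. *)
Fixpoint piece n (k : nat) : R :=
  if n is n'.+1 then
    piece n' (k %/ M %/ N n')%N + (k %/ M %% N n')%:R * cellw n'
    + digit_off n' (k %% M)%N
  else k%:R * w 0%N.

Definition cell n (c : nat) : R :=
  piece n (c %/ N n)%N + (c %% N n)%:R * cellw n.

Lemma pieceS n j : piece n.+1 j = cell n (j %/ M)%N + digit_off n (j %% M)%N.
Proof. by []. Qed.

Hypothesis M2 : (1 < M)%N.
Hypothesis N0 : forall n, (0 < N n)%N.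
Hypothesis w0 : forall n, 0 < w n.
(* With r_n / 3 as the end of the last piece, the constant 12 keeps every point of
   the piece of digit 0 at distance at least r_n / 4 from that end. *)
Hypothesis wS : forall n, M%:R * w n.+1 <= cellw n / 12%:R.

Let M0 : (0 < M)%N. Proof. exact: ltnW. Qed.

Lemma cellw_gt0 n : 0 < cellw n.
Proof. by rewrite divr_gt0// ltr0n. Qed.

Lemma cellwE n : (N n)%:R * cellw n = w n.
Proof. by rewrite /cellw mulrC divfK// pnatr_eq0 -lt0n. Qed.

Lemma cellw_le n : cellw n <= w n.
Proof. by rewrite -[leRHS]cellwE ler_peMl ?ler1n// ltW// cellw_gt0. Qed.

Lemma wS_le n : w n.+1 <= cellw n / 24%:R.
Proof.
have := wS n; have := w0 n.+1; have : 2 <= M%:R :> R by rewrite ler_nat.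
nra.
Qed.

Lemma pieces_gt0 n : (0 < pieces n)%N.
Proof. by elim: n => //= n ih; rewrite !muln_gt0 ih N0. Qed.

Lemma cells_gt0 n : (0 < cells n)%N.
Proof. by rewrite muln_gt0 pieces_gt0 N0. Qed.

Lemma cellsM n : (cells n)%:R * cellw n = (pieces n)%:R * w n.
Proof. by rewrite natrM -mulrA cellwE. Qed.

Lemma digit_off_bounds n i : (i < M)%N ->
  0 <= digit_off n i /\ digit_off n i + w n.+1 <= cellw n / 3.
Proof.
move=> iM; rewrite /digit_off; have c0 := cellw_gt0 n; have w1 := w0 n.+1.
have wS1 := wS n; have wS2 := wS_le n.
have M2' : 2 <= M%:R :> R by rewrite ler_nat.
case: eqP => [_|/eqP i0]; first by split => //; lra.
have : (M - i)%:R <= M%:R :> R by rewrite ler_nat leq_subr.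
have : 1 <= (M - i)%:R :> R by rewrite ler1n subn_gt0.
by split; nra.
Qed.

Lemma digit_offS n i : (i.+1 < M)%N ->
  digit_off n i + w n.+1 <= digit_off n i.+1.
Proof.
move=> iM; rewrite /digit_off /=; have c0 := cellw_gt0 n; have w1 := w0 n.+1.
have wS1 := wS n.
case: eqP => [->|/eqP i0].
  have : (M - 1)%:R <= M%:R :> R by rewrite ler_nat leq_subr.
  have : 1 <= M%:R :> R by rewrite ler1n.
  nra.
have -> : (M - i)%:R = (M - i.+1)%:R + 1 :> R by rewrite natr1 subnSK// ltnW.
lra.
Qed.

Lemma divn_modnS k p : (0 < p)%N ->
  [/\ k.+1 %/ p = k %/ p, k.+1 %% p = (k %% p).+1 & (k %% p).+1 < p]%N \/
  [/\ k.+1 %/ p = (k %/ p).+1, k.+1 %% p = 0 & (k %% p).+1 = p]%N.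
Proof.
move=> p0; have := ltn_pmod k p0; rewrite leq_eqVlt => /orP[/eqP e|lt].
  right; have e1 : (k.+1 = (k %/ p).+1 * p)%N.
    by rewrite {1}(divn_eq k p) -addnS e mulSn addnC.
  by rewrite e1 mulnK// modnMl.
left; have e1 : (k.+1 = k %/ p * p + (k %% p).+1)%N.
  by rewrite addnS -divn_eq.
split=> //; first by rewrite {1}e1 divnMDl// (divn_small lt) addn0.
by rewrite {1}e1 modnMDl modn_small.
Qed.

(** Cells of the same piece are adjacent, and the last cell of a piece ends where the
piece ends, hence before the next piece starts. *)
Lemma cell_step_of n : (forall k, piece n k + w n <= piece n k.+1) ->
  forall c, cell n c + cellw n <= cell n c.+1.
Proof.
move=> pw c; rewrite /cell; have [[-> -> H]|[-> -> H]] := divn_modnS c (N0 n).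
  by rewrite -natr1 mulrDl mul1r addrA.
rewrite mul0r addr0; apply: le_trans (pw _).
rewrite -addrA lerD2l -[leRHS]cellwE -{2}H -natr1; lra.
Qed.

Lemma piece_step n k : piece n k + w n <= piece n k.+1.
Proof.
elim: n k => [|n ih] k; first by rewrite /= -natr1 mulrDl mul1r.
rewrite !pieceS; have [[-> -> H]|[-> -> H]] := divn_modnS k M0.
  by rewrite -addrA lerD2l digit_offS.
have [_ H1] := digit_off_bounds n (ltn_pmod k M0).
have H2 := cell_step_of ih (k %/ M)%N.
have := cellw_gt0 n; rewrite {2}/digit_off eqxx; lra.
Qed.

Lemma cell_step n c : cell n c + cellw n <= cell n c.+1.
Proof. exact: cell_step_of (piece_step n) _. Qed.

Lemma cell_in_piece n c :
  piece n (c %/ N n)%N <= cell n c /\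
  cell n c + cellw n <= piece n (c %/ N n)%N + w n.
Proof.
rewrite /cell; have c0 := cellw_gt0 n; split.
  by rewrite lerDl mulr_ge0// ltW.
rewrite -addrA lerD2l -[leRHS]cellwE.
have : ((c %% N n).+1)%:R <= (N n)%:R :> R by rewrite ler_nat ltn_pmod.
rewrite -natr1; nra.
Qed.

Lemma piece_in_cell n j :
  cell n (j %/ M)%N <= piece n.+1 j /\
  piece n.+1 j + w n.+1 <= cell n (j %/ M)%N + cellw n / 3.
Proof.
rewrite pieceS; have [H1 H2] := digit_off_bounds n (ltn_pmod j M0).
by split; lra.
Qed.

(** Index of the piece of generation n that contains the point coded by om; pieces of
generation n are coded by the intervals of length 1 / Q_n. *)
Definition pidx n (om : R) : nat := Num.truncn (om * (pieces n)%:R).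
Definition cidx n (om : R) : nat := Num.truncn (om * (cells n)%:R).

Lemma cidx_div n om : (cidx n om %/ N n)%N = pidx n om.
Proof. by rewrite /cidx /cells natrM mulrA truncn_mulr_divn. Qed.

Lemma pidxS_div n om : (pidx n.+1 om %/ M)%N = cidx n om.
Proof. by rewrite /pidx /= natrM mulrA truncn_mulr_divn. Qed.

(** The left ends of the nested pieces with the digits of om increase to the point. *)
Definition coding (om : R) : R := sup (range (fun n => piece n (pidx n om))).

Lemma piece_nested n m om : (n <= m)%N ->
  piece n (pidx n om) <= piece m (pidx m om) /\
  piece m (pidx m om) + w m <= piece n (pidx n om) + w n.
Proof.
elim: m => [|m ih]; first by rewrite leqn0 => /eqP->.
rewrite leq_eqVlt => /orP[/eqP->//|]; rewrite ltnS => /ih [H1 H2].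
have [H3 H4] := piece_in_cell m (pidx m.+1 om); rewrite pidxS_div in H3 H4.
have [H5 H6] := cell_in_piece m (cidx m om); rewrite cidx_div in H5 H6.
have := cellw_gt0 m; split; lra.
Qed.

Lemma piece_pidx_ub n m om :
  piece m (pidx m om) <= piece n (pidx n om) + w n.
Proof.
have w_n := w0 n; have w_m := w0 m.
by have [/piece_nested-/(_ om)[]|/ltnW/piece_nested-/(_ om)[]] := leqP m n; lra.
Qed.

Lemma coding_in_piece n om :
  piece n (pidx n om) <= coding om <= piece n (pidx n om) + w n.
Proof.
apply/andP; split.
  apply: ub_le_sup; last by exists n.
  by exists (piece 0 (pidx 0 om) + w 0) => _ [m _ <-]; exact: piece_pidx_ub.
apply: ge_sup; first by exists (piece 0 (pidx 0 om)), 0%N.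
by move=> _ [m _ <-]; exact: piece_pidx_ub.
Qed.

Lemma coding_in_cell n om :
  cell n (cidx n om) <= coding om <= cell n (cidx n om) + cellw n / 3.
Proof.
have /andP[H1 H2] := coding_in_piece n.+1 om.
have [H3 H4] := piece_in_cell n (pidx n.+1 om); rewrite pidxS_div in H3 H4.
by apply/andP; split; lra.
Qed.

Lemma le_pidx n om om' : om <= om' -> (pidx n om <= pidx n om')%N.
Proof. by move=> h; rewrite le_truncn// ler_wpM2r. Qed.

Lemma coding_nd : {homo coding : x y / x <= y}.
Proof.
move=> x y xy; apply: ge_sup; first by exists (piece 0 (pidx 0 x)), 0%N.
move=> _ [n _ <-]; have /andP[+ _] := coding_in_piece n y; apply: le_trans.
have /(step_le_add (piece_step n)) := le_pidx n xy; apply: le_trans.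
by rewrite lerDl mulr_ge0// ltW.
Qed.

(* expansion: distances of codes control distances of points *)
(** Two points with cells far apart in the numbering are far apart on the line, since
each intermediate cell takes the room [cellw n]. This bounds the mass of short
intervals from above. *)
Lemma coding_expand n om om' : 0 <= om -> om <= om' ->
  (om' - om) * (cells n)%:R <= (coding om' - coding om) / cellw n + 2.
Proof.
move=> om0 le_om; have c0 := cellw_gt0 n.
have /andP[H1 H2] := coding_in_cell n om.
have /andP[H3 H4] := coding_in_cell n om'.
have D0 : 0 <= om * (cells n)%:R by rewrite mulr_ge0.
have D0' : 0 <= om' * (cells n)%:R by rewrite mulr_ge0// (le_trans om0).
have /andP[E1 E2] := truncn_itv D0; have /andP[E3 E4] := truncn_itv D0'.
rewrite -/(cidx n om) -/(cidx n om') in E1 E2 E3 E4.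
have cc : (cidx n om <= cidx n om')%N by rewrite le_truncn// ler_wpM2r.
have H := step_le_add (cell_step n) cc.
rewrite natrB// in H; rewrite -natr1 in E4.
rewrite -lerBlDr ler_pdivlMr//.
nra.
Qed.

(* contraction inside a piece *)
Lemma coding_same_piece n om om' : pidx n om = pidx n om' ->
  `|coding om - coding om'| <= w n.
Proof.
move=> e; have /andP[H1 H2] := coding_in_piece n om.
have /andP[H3 H4] := coding_in_piece n om'; rewrite e in H1 H2.
rewrite ler_norml; apply/andP; split; lra.
Qed.

(** Inside a piece the cells are adjacent, so the distance between points is also
bounded by the number of cells between them. This bounds the mass of intervals from
below. *)
Lemma coding_contract n om om' : 0 <= om -> om <= om' ->
  pidx n om = pidx n om' ->
  coding om' - coding om <= ((om' - om) * (cells n)%:R + 2) * cellw n.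
Proof.
move=> om0 le_om e; have c0 := cellw_gt0 n.
have /andP[H1 H2] := coding_in_cell n om.
have /andP[H3 H4] := coding_in_cell n om'.
have D0 : 0 <= om * (cells n)%:R by rewrite mulr_ge0.
have D0' : 0 <= om' * (cells n)%:R by rewrite mulr_ge0// (le_trans om0).
have /andP[E1 E2] := truncn_itv D0; have /andP[E3 E4] := truncn_itv D0'.
rewrite -/(cidx n om) -/(cidx n om') in E1 E2 E3 E4.
have H : cell n (cidx n om') - cell n (cidx n om) =
    ((cidx n om')%:R - (cidx n om)%:R) * cellw n.
  rewrite /cell !cidx_div e.
  rewrite [in RHS](divn_eq (cidx n om') (N n)) [in RHS](divn_eq (cidx n om) (N n)).
  by rewrite !cidx_div e !natrD; ring.
rewrite -natr1 in E2.
nra.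
Qed.

End scheme.

(** * The uniform law on the unit interval and mixed radix digits *)

Definition unif01 (R : realType) : probability (measurableTypeR R) R :=
  uniform_prob (@ltr01 R).

(** The half-open interval is used because it is a disjoint union of q intervals
[k/q, (k+1)/q[. *)
Lemma unif01E (R : realType) (A : set (measurableTypeR R)) : measurable A ->
  unif01 R A = lebesgue_measure (A `&` `[0, 1[%classic).
Proof.
move=> mA; have mI : measurable (A `&` `[0, 1]%classic) by exact: measurableI.
have mI' : measurable (A `&` `[0, 1[%classic) by exact: measurableI.
transitivity (lebesgue_measure (A `&` `[0, 1]%classic)).
  rewrite /unif01 /= /uniform_prob integral_uniform_pdf.
  rewrite (eq_integral (cst 1%E)) ?integral_cst ?mul1e//=.
  move=> x /set_mem[_ /=]; rewrite in_itv/= /uniform_pdf => ->.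
  by rewrite subr0 invr1.
apply/eqP; rewrite eq_le; apply/andP; split.
  apply: le_trans (_ : (lebesgue_measure
     ((A `&` `[0%R, 1%R[%classic) `|` [set 1%R]) <= _)%E); last first.
    apply: le_trans (measureU2 _ _ _) _ => //.
    rewrite [X in (_ + X <= _)%E](_ : _ = 0%E) ?adde0//.
    exact: lebesgue_measure_set1.
  apply: le_measure; rewrite ?inE//; first exact: measurableU.
  move=> x [Ax /=]; rewrite !in_itv/= => /andP[x0].
  by rewrite le_eqVlt => /orP[/eqP->|x1]; [right|left; rewrite x0 x1].
apply: le_measure; rewrite ?inE// => x [Ax /=]; rewrite !in_itv/=.
by move=> /andP[-> /ltW].
Qed.

Lemma unif01_le (R : realType) (A : set (measurableTypeR R)) (x h : R) :
  measurable A -> 0 <= h ->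
  (forall y, A y -> 0 <= y < 1 -> x - h <= y <= x + h) ->
  (unif01 R A <= (2 * h)%:E)%E.
Proof.
move=> mA h0 Ah; rewrite unif01E//.
apply: le_trans (_ : (lebesgue_measure `[(x - h)%R, (x + h)%R]%classic <= _)%E).
  apply: le_measure; rewrite ?inE//; first exact: measurableI.
  by move=> y [Ay /=]; rewrite !in_itv/=; exact: Ah.
rewrite lebesgue_measure_itv/= lte_fin; case: ifPn => _; last first.
  by rewrite lee_fin mulr_ge0.
by rewrite -EFinB lee_fin; lra.
Qed.

Lemma unif01_ge (R : realType) (A : set (measurableTypeR R)) (a b : R) :
  measurable A -> 0 <= a -> b <= 1 ->
  (forall y, a < y < b -> A y) -> ((b - a)%:E <= unif01 R A)%E.
Proof.
move=> mA a0 b1 abA; have [ab|ba] := ltP a b; last first.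
  by apply: le_trans (measure_ge0 _ _); rewrite lee_fin subr_le0.
have -> : (b - a)%:E = lebesgue_measure `]a, b[%classic.
  by rewrite lebesgue_measure_itv/= lte_fin ab.
rewrite unif01E//; apply: le_measure; rewrite ?inE//; first exact: measurableI.
move=> y /=; rewrite !in_itv/= => /andP[ay yb]; split.
  by apply: abA; rewrite ay yb.
by rewrite (ltW (le_lt_trans a0 ay)) (lt_le_trans yb b1).
Qed.

Lemma measurable_truncn_pred (R : realType) (q : nat) (P : pred nat) :
  measurable ([set om | P (Num.truncn (om * q%:R))] : set (measurableTypeR R)).
Proof.
have mf : measurable_fun setT (fun om : R => (Num.truncn (om * q%:R))%:R : R).
  apply: nondecreasing_measurable => // x y xy.
  by rewrite ler_nat le_truncn// ler_wpM2r.
rewrite (_ : mkset _ =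
    \bigcup_k (if P k then (fun om : R => (Num.truncn (om * q%:R))%:R : R)
        @^-1` [set k%:R]
     else set0)); last first.
  apply/seteqP; split => [om /= Pom|om [k _]].
    by exists (Num.truncn (om * q%:R)) => //; rewrite Pom.
  by case: ifPn => // Pk /= /eqP; rewrite eqr_nat => /eqP ->.
apply: bigcupT_measurable => k; case: ifPn => // _.
by rewrite -[X in measurable X]setTI; apply: mf.
Qed.

Lemma unif01_truncn (R : realType) (q : nat) (P : pred nat) : (0 < q)%N ->
  unif01 R [set om | P (Num.truncn (om * q%:R))] =
  ((\sum_(0 <= k < q) P k)%N%:R / q%:R)%:E.
Proof.
move=> q0; have q0' : 0 < q%:R :> R by rewrite ltr0n.
rewrite unif01E; last exact: measurable_truncn_pred.
have E : [set om : R | P (Num.truncn (om * q%:R))] `&` `[0, 1[%classic =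
  \big[setU/set0]_(k < q | P k) `[k%:R / q%:R, k.+1%:R / q%:R[%classic.
  rewrite -(bigcup_pred [pred k : 'I_q | P k]).
  apply/seteqP; split => [om [/= Pom]|om [k /= Pk]].
    rewrite in_itv/= => /andP[om0 om1].
    have h0 : 0 <= om * q%:R by rewrite mulr_ge0.
    have lq : (Num.truncn (om * q%:R) < q)%N by rewrite truncn_lt_nat// gtr_pMl.
    exists (Ordinal lq) => //.
    by rewrite /= in_itv/= ler_pdivrMr// ltr_pdivlMr// truncn_itv.
  rewrite in_itv/= ler_pdivrMr// ltr_pdivlMr// => H.
  rewrite (truncn_def H) in_itv/=; split => //; case/andP: H => H1 H2.
  apply/andP; split; first by rewrite -(pmulr_lge0 _ q0') (le_trans _ H1).
  by rewrite -(ltr_pM2r q0') mul1r (lt_le_trans H2)// ler_nat.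
rewrite E measure_bigsetU_ord_cond//; last first.
  apply/trivIsetP => i j _ _ ij; apply/seteqP; split => // om [].
  rewrite /= !in_itv/= !ler_pdivrMr// !ltr_pdivlMr// => H1 H2.
  have := truncn_def H1; rewrite (truncn_def H2) => /val_inj e.
  by rewrite e eqxx in ij.
rewrite (eq_bigr (fun=> (q%:R^-1)%:E)); last first.
  move=> k _; apply: etrans (lebesgue_measure_itv _) _;
      rewrite /= lte_fin ltr_pM2r ?invr_gt0// ltr_nat ltnSn.
  by rewrite -EFinB -mulrBl -natrB ?leqnSn// subSnn mul1r.
rewrite sumEFin; congr EFin; rewrite big_mkord natr_sum mulr_suml big_mkcond/=.
by apply: eq_bigr => k _; case: (P k); rewrite ?mul1r ?mul0r.
Qed.

Lemma sum_pred_divn_modn (q b : nat) (P S : pred nat) :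
  (\sum_(0 <= j < q * b) (P (j %/ b) && S (j %% b)))%N =
  ((\sum_(0 <= k < q) P k) * (\sum_(0 <= i < b) S i))%N.
Proof.
rewrite big_nat_mul big_distrl/=; apply: eq_bigr => k _.
rewrite big_distrr/= -[(k * b)%N]add0n big_addn mulSnr addKn.
rewrite big_nat [RHS]big_nat; apply: eq_bigr => i /andP[_ ib].
rewrite addnC divnMDl ?(leq_ltn_trans _ ib)// divn_small// addn0.
by rewrite modnMDl modn_small// mulnb.
Qed.

(** The last digit in base b is independent of the preceding ones. *)
Lemma unif01_digit (R : realType) (q b : nat) (P S : pred nat) :
  (0 < q)%N -> (0 < b)%N ->
  unif01 R [set om | let j := Num.truncn (om * (q * b)%:R) in
    P (j %/ b)%N && S (j %% b)%N] =
  (unif01 R [set om | P (Num.truncn (om * q%:R))] *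
   ((\sum_(0 <= i < b) S i)%N%:R / b%:R)%:E)%E.
Proof.
move=> q0 b0.
rewrite (@unif01_truncn R (q * b) (fun j => P (j %/ b)%N && S (j %% b)%N))
    ?muln_gt0 ?q0//.
rewrite sum_pred_divn_modn unif01_truncn// -EFinM; congr EFin.
by rewrite !natrM mulf_div.
Qed.

(** * Masses of intervals *)

Lemma pushforward_probability d d' (T : measurableType d) (T' : measurableType d')
    (R : realType) (P : probability T R) (f : T -> T') :
  measurable_fun setT f ->
  exists Q : probability T' R, forall A, measurable A -> Q A = P (f @^-1` A).
Proof.
move=> mf; pose X : {mfun T >-> T'} := HB.pack f (isMeasurableFun.Build _ _ _ _ f mf).
by exists (distribution P X).
Qed.

(** Typed as a set of [measurableTypeR R], the measurable structure that carries
[unif01]. *)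
Definition ivl (R : realType) (x r : R) : set (measurableTypeR R) :=
  `[x - r, x + r]%classic.

Lemma ivlE (R : realType) (x r y : R) : ivl x r y = (x - r <= y <= x + r) :> Prop.
Proof. by rewrite /ivl /= in_itv. Qed.

Lemma measurable_ivl (R : realType) (x r : R) : measurable (ivl x r).
Proof. exact: measurable_itv. Qed.
#[local] Hint Resolve measurable_ivl : core.

(** A share at most 1 only increases when it is raised to an exponent s <= 1. This is
what makes a mass that is linear between two scales lie above or below a power of
the scale. *)
Lemma ler_powR_ratio (R : realType) (s x y : R) : 0 < x -> x <= y -> 0 <= s <= 1 ->
  x / y <= x `^ s / y `^ s.
Proof.
move=> x0 xy /andP[s0 s1]; have y0 := lt_le_trans x0 xy.
have xy01 : 0 < x / y <= 1 by rewrite divr_gt0//= ler_pdivrMr// mul1r.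
apply: le_trans (ger1_powR xy01 s1) _.
rewrite powRM ?invr_ge0 ?(ltW x0) ?(ltW y0)//.
by rewrite -powR_inv1 ?(ltW y0)// -powRrM mulN1r powRN.
Qed.

Section cantor_measure.
Context {R : realType}.
Variables (M : nat) (N : nat -> nat) (w : nat -> R).
Hypothesis M2 : (1 < M)%N.
Hypothesis N0 : forall n, (0 < N n)%N.
Hypothesis w0 : forall n, 0 < w n.
Hypothesis wS : forall n, M%:R * w n.+1 <= cellw N w n / 12%:R.
Variables (s t c0 C0 : R).
Hypothesis s01 : 0 <= s <= 1.
Hypothesis t01 : 0 <= t <= 1.
Hypothesis c00 : 0 < c0.
Hypothesis C00 : 0 < C0.
Local Notation phi := (coding M N w).
Local Notation r := (cellw N w).
Local Notation Q := (pieces M N).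
Local Notation D := (cells M N).
Hypothesis HQ : forall n, c0 <= (Q n)%:R * w n `^ s <= C0.
Hypothesis HD : forall n, c0 <= (D n)%:R * r n `^ t <= C0.

Variable nu : probability (measurableTypeR R) R.
Hypothesis nuE : forall A, measurable A -> nu A = unif01 R (phi @^-1` A).

Let M0 : (0 < M)%N. Proof. exact: ltnW. Qed.
Let r0 n : 0 < r n. Proof. exact: cellw_gt0. Qed.
Let Q0 n : 0 < (Q n)%:R :> R. Proof. by rewrite ltr0n pieces_gt0. Qed.
Let D0 n : 0 < (D n)%:R :> R. Proof. by rewrite ltr0n cells_gt0. Qed.

Lemma wS_half n : w n.+1 <= w n / 2.
Proof.
have := wS_le M2 w0 wS n; have := cellw_le N0 w0 n; have := r0 n; lra.
Qed.

Lemma w_le n : w n <= w 0 / 2 ^+ n.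
Proof.
elim: n => [|n ih]; first by rewrite expr0 divr1.
by have := wS_half n; rewrite exprSr invfM mulrA; lra.
Qed.

Lemma w_small e : 0 < e -> exists n, w n < e.
Proof.
move=> e0; have [n] : exists n, w 0 < e * 2 ^+ n.
  exists (Num.truncn (w 0 / e)).+1; rewrite -ltr_pdivrMl// mulrC.
  apply: lt_le_trans (truncnS_gt _) _; rewrite -natrX ler_nat ltnW//.
  exact: ltn_expl.
by exists n; apply: le_lt_trans (w_le n) _; rewrite ltr_pdivrMr// exprn_gt0.
Qed.

Lemma measurable_coding_pre A : measurable A ->
  measurable (phi @^-1` A : set (measurableTypeR R)).
Proof.
move=> mA; have mphi : measurable_fun setT (phi : measurableTypeR R ->
    measurableTypeR R).
  by apply: nondecreasing_measurable => //; exact: coding_nd.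
by rewrite -[X in measurable X]setTI; exact: mphi.
Qed.

(** The codes of the points of an interval of radius p lie at distance at most
(2 p / r_n + 2) / D_n from each other by [coding_expand]. *)
Lemma nu_ball_le n x p : 0 <= p ->
  (nu (ivl x p) <= (2 * ((2 * p / r n + 2) / (D n)%:R))%:E)%E.
Proof.
move=> p0; rewrite nuE; last exact: measurable_ivl.
have h0 : 0 <= (2 * p / r n + 2) / (D n)%:R.
  apply: divr_ge0 => //; apply: addr_ge0 => //.
  by apply: divr_ge0; [exact: mulr_ge0|exact: ltW].
have [[om [/= om1 om2]]|no] := pselect (exists om, ivl x p (phi om) /\ 0 <= om < 1).
  apply: (@unif01_le _ _ om) => //;
      first exact: (measurable_coding_pre (measurable_ivl _ _)).
  move=> om' /= om'1 om'2; move: om1 om'1; rewrite !ivlE => om1 om'1.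
  have K a b : 0 <= a -> a <= b -> phi b - phi a <= 2 * p ->
      b - a <= (2 * p / r n + 2) / (D n)%:R.
    move=> a0 ab H; rewrite ler_pdivlMr//.
    apply: le_trans (coding_expand M2 N0 w0 wS n a0 ab) _.
    by rewrite lerD2r ler_pM2r// invr_gt0.
  have [le|/ltW le] := leP om om'.
    have := K _ _ (proj1 (andP om2)) le; lra.
  have := K _ _ (proj1 (andP om'2)) le; lra.
apply: (@unif01_le _ _ 0) => //;
    first exact: (measurable_coding_pre (measurable_ivl _ _)).
by move=> om Aom om01; case: no; exists om.
Qed.

Lemma scale_index p : 0 < p -> p < w 0 -> exists n, w n.+1 <= p < w n.
Proof.
move=> p0 pw; have [n0 n0p] := w_small p0.
have ex : exists n, w n <= p by exists n0; exact: ltW.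
case: (ex_minnP ex) => -[|n] wn nmin; first by move: pw; rewrite ltNge wn.
exists n; rewrite wn ltNge; apply/negP => /nmin; by rewrite ltnn.
Qed.

(** Between the scales w_(n+1) and r_n an interval meets boundedly many cells, each of
mass M / Q_(n+1), and w_(n+1) ^ s is comparable with 1 / Q_(n+1). Between r_n and
w_n the bound is linear in p, and equal to w_n ^ s for p = w_n up to a constant,
so that [ler_powR_ratio] applies. *)
Lemma nu_upper : exists2 C1, 0 < C1 & forall x p, 0 < p < 1 ->
  (nu (ivl x p) <= (C1 * p `^ s)%:E)%E.
Proof.
have M1 : 1 <= M%:R :> R by rewrite ler1n.
exists (8 * M%:R / c0 + (w 0 `^ s)^-1).
  by rewrite addr_gt0 ?divr_gt0 ?invr_gt0 ?powR_gt0 ?mulr_gt0 ?ltr0n.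
move=> x p /andP[p0 p1].
have ps0 : 0 < p `^ s by rewrite powR_gt0.
have c8 : 8 / c0 <= 8 * M%:R / c0 by rewrite ler_pM2r ?invr_gt0//; nra.
have ws0 : 0 < (w 0 `^ s)^-1 by rewrite invr_gt0 powR_gt0.
have C8 : 0 < 8 / c0 by rewrite divr_gt0.
have [pw|wp] := ltP p (w 0); last first.
  apply: le_trans (probability_le1 _ _) _ => //.
  rewrite lee_fin mulrDl; apply: le_trans (_ : (w 0 `^ s)^-1 * p `^ s <= _).
    rewrite ler_pdivlMl ?powR_gt0// mulr1; case/andP: s01 => s0 _.
    by rewrite ge0_ler_powR// nnegrE ltW.
  by rewrite lerDr mulr_ge0// ltW// (lt_le_trans C8).
have [n /andP[wn1 wn]] := scale_index p0 pw.
have [rp|pr] := leP (r n) p.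
  apply: le_trans (nu_ball_le n x (ltW p0)) _; rewrite lee_fin.
  apply: le_trans (_ : 8 / c0 * p `^ s <= _); last by rewrite ler_pM2r//; lra.
  apply: le_trans (_ : 8 * (p / w n) / (Q n)%:R <= _).
    have H : 2 <= 2 * p / r n by rewrite ler_pdivlMr//; lra.
    have -> : 8 * (p / w n) / (Q n)%:R = 2 * ((2 * p / r n + 2 * p / r n) / (D n)%:R).
      have e : (D n)%:R * r n = (Q n)%:R * w n by rewrite cellsM.
      transitivity (8 * p / ((Q n)%:R * w n)); first by field; rewrite !gt_eqF.
      by rewrite -e; field; rewrite !gt_eqF.
    by rewrite ler_pM2l// ler_pM2r ?invr_gt0// lerD2l.
  have /andP[hq _] := HQ n.
  have H := ler_powR_ratio p0 (ltW wn) s01.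
  have W0 : 0 < w n `^ s by rewrite powR_gt0.
  apply: le_trans (_ : 8 * (p `^ s / w n `^ s) / (Q n)%:R <= _).
    by rewrite ler_pM2r ?invr_gt0// ler_pM2l.
  rewrite -!mulrA ler_pM2l// [leRHS]mulrC ler_pM2l// -invfM.
  by rewrite lef_pV2 ?posrE ?mulr_gt0// mulrC.
apply: le_trans (nu_ball_le n x (ltW p0)) _; rewrite lee_fin.
apply: le_trans (_ : 8 * M%:R / c0 * p `^ s <= _); last by rewrite ler_pM2r//; lra.
have H : 2 * p / r n <= 2 by rewrite ler_pdivrMr//; lra.
apply: le_trans (_ : 8 / (D n)%:R <= _).
  rewrite mulrA ler_pM2r ?invr_gt0//; lra.
have /andP[hq _] := HQ n.+1.
rewrite /= -/(D n) natrM in hq.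
have le : w n.+1 `^ s <= p `^ s by case/andP: s01 => s0 _;
    rewrite ge0_ler_powR// nnegrE ltW.
have -> : 8 * M%:R / c0 * p `^ s = 8 * (M%:R / c0 * p `^ s) by ring.
rewrite ler_pM2l// -[leLHS]mul1r ler_pdivrMr//.
apply: le_trans (_ : (D n)%:R * M%:R * w n.+1 `^ s / c0 <= _).
  by rewrite ler_pdivlMr ?mul1r.
have -> : M%:R / c0 * p `^ s * (D n)%:R = (D n)%:R * M%:R * p `^ s / c0 by ring.
by rewrite ler_pM2r ?invr_gt0// ler_pM2l// mulr_gt0// ltr0n.
Qed.

(** At the scale of the cells the mass is as small as the exponent t allows: a ball
meets boundedly many cells, each of mass 1 / D_n. *)
Lemma nu_upper_cellw n x : (nu (ivl x (r n)) <= (8 / c0 * r n `^ t)%:E)%E.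
Proof.
apply: le_trans (nu_ball_le n x (ltW (r0 n))) _; rewrite lee_fin.
rewrite -mulrA divff ?gt_eqF// mulr1.
have /andP[hd _] := HD n.
rewrite mulrA ler_pdivrMr// -!mulrA mulrCA ler_pdivlMl// [leRHS]mulrCA [r n `^ t * _]mulrC.
lra.
Qed.

Lemma nu_piece n om : 0 <= om < 1 ->
  (((Q n)%:R^-1)%:E <= nu (ivl (phi om) (w n)))%E.
Proof.
move=> /andP[om0 om1]; rewrite nuE; last exact: measurable_ivl.
have q0 : 0 <= om * (Q n)%:R by rewrite mulr_ge0.
set k := pidx M N n om.
have kQ : (k < Q n)%N by rewrite /k /pidx truncn_lt_nat// gtr_pMl.
have -> : (Q n)%:R^-1 = k.+1%:R / (Q n)%:R - k%:R / (Q n)%:R :> R.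
  by rewrite -mulrBl -natrB// subSnn mul1r.
apply: unif01_ge; first exact: (measurable_coding_pre (measurable_ivl _ _)).
- by rewrite divr_ge0.
- by rewrite ler_pdivrMr// mul1r ler_nat.
move=> y; rewrite ltr_pdivrMr// ltr_pdivlMr// => /andP[y1 y2].
have e : pidx M N n om = pidx M N n y.
  by rewrite -/k; apply/esym/truncn_def; rewrite (ltW y1) y2.
have := coding_same_piece M2 N0 w0 wS e; rewrite /= ivlE ler_norml; lra.
Qed.

(** Codes in the same interval of length 1 / Q_n and at distance at most p / (2 r_n D_n)
from om give points at distance at most p / 2 + 2 r_n <= p. At least one side of om
has room for an interval of this length of codes. *)
Lemma nu_piece_part n om p : 0 <= om < 1 -> 4 * r n <= p -> p <= w n ->
  ((p / (2 * r n * (D n)%:R))%:E <= nu (ivl (phi om) p))%E.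
Proof.
move=> /andP[om0 om1] rp pw; rewrite nuE; last exact: measurable_ivl.
have rn := r0 n; have Dn := D0 n; have Qn := Q0 n.
have q0 : 0 <= om * (Q n)%:R by rewrite mulr_ge0.
set k := pidx M N n om.
have kQ : (k < Q n)%N by rewrite /k /pidx truncn_lt_nat// gtr_pMl.
set h := p / _.
have p0 : 0 < p by lra.
have h0 : 0 < h.
  apply: divr_gt0 => //; apply: mulr_gt0 => //; exact: mulr_gt0.
have hD : h * (D n)%:R * r n = p / 2 by rewrite /h; field; rewrite !gt_eqF.
have hQ : h * (Q n)%:R <= 2^-1.
  have e : (D n)%:R * r n = (Q n)%:R * w n by rewrite cellsM.
  have -> : h = p / (2 * (Q n)%:R * w n) by rewrite /h -mulrA [r n * _]mulrC e mulrA.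
  have -> : p / (2 * (Q n)%:R * w n) * (Q n)%:R = p / w n / 2.
    by field; rewrite !gt_eqF.
  have : p / w n <= 1 by rewrite ler_pdivrMr// mul1r.
  by move=> H; lra.
have /andP[k1 k2] := truncn_itv q0; rewrite -/(pidx M N n om) -/k in k1 k2.
have near y : `|y - om| <= h -> k%:R <= y * (Q n)%:R < k.+1%:R ->
    (phi @^-1` ivl (phi om) p) y.
  move=> yom yk; rewrite /= ivlE.
  have e : pidx M N n om = pidx M N n y by rewrite -/k; apply/esym/truncn_def.
  have y0 : 0 <= y.
    by rewrite -(pmulr_lge0 _ Qn); apply: le_trans (proj1 (andP yk)).
  have fin a b : 0 <= a -> a <= b -> b - a <= h -> pidx M N n a = pidx M N n b ->
      phi b - phi a <= p.
    move=> a0 ab bah eab.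
    apply: le_trans (coding_contract M2 N0 w0 wS a0 ab eab) _.
    have : (b - a) * (D n)%:R * r n <= h * (D n)%:R * r n.
      by rewrite !ler_pM2r.
    rewrite mulrDl hD; lra.
  have [le|/ltW le] := leP om y.
    have nd := coding_nd M2 N0 w0 wS le.
    have := fin _ _ om0 le _ e; rewrite ger0_norm ?subr_ge0// in yom.
    move=> /(_ yom); lra.
  have nd := coding_nd M2 N0 w0 wS le.
  have := fin _ _ y0 le _ (esym e); rewrite ler0_norm ?subr_le0// opprB in yom.
  move=> /(_ yom); lra.
have K1 : k%:R + 1 <= (Q n)%:R :> R by rewrite natr1 ler_nat.
rewrite -natr1 in k2 near.
have k0 : 0 <= k%:R :> R by [].
(* The side of om that is the longer one in its interval of codes. *)
have [half|half] := leP (om * (Q n)%:R) (k%:R + 2^-1).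
  have -> : h = (om + h) - om by rewrite addrC addKr.
  apply: unif01_ge => //; first exact: (measurable_coding_pre (measurable_ivl _ _)).
    rewrite -(ler_pM2r Qn) mulrDl; lra.
  move=> y /andP[y1 y2]; apply: near.
    rewrite ger0_norm; lra.
  have := y1; rewrite -(ltr_pM2r Qn) => y1'.
  have := y2; rewrite -(ltr_pM2r Qn) mulrDl => y2'.
  apply/andP; split; lra.
have -> : h = om - (om - h) by rewrite subKr.
apply: unif01_ge => //; first exact: (measurable_coding_pre (measurable_ivl _ _)).
- rewrite -(pmulr_lge0 _ Qn) mulrBl; lra.
- exact: ltW.
move=> y /andP[y1 y2]; apply: near.
  rewrite ler0_norm; lra.
have := y2; rewrite -(ltr_pM2r Qn) => y2'.
have := y1; rewrite -(ltr_pM2r Qn) mulrBl => y1'.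
apply/andP; split; lra.
Qed.

(** Closed, so that it is measurable; the estimates from below pass from the range of
the coding to its closure at the price of a factor 2 in the radius. *)
Definition coding_support : set R := closure (phi @` [set om | 0 <= om < 1]).

Lemma coding_support_approx x e : coding_support x -> 0 < e ->
  exists om, 0 <= om < 1 /\ `|x - phi om| < e.
Proof.
move=> Kx e0; have [y [[om om01 <-] +]] := Kx _ (nbhsx_ballx x e e0).
by exists om.
Qed.

Lemma ivl_sub (x y p q : R) : `|x - y| <= q -> ivl y p `<=` ivl x (p + q).
Proof.
move=> xy z; rewrite !ivlE; move: xy; rewrite ler_norml; lra.
Qed.

(** Between w_(n+1) and 4 r_n a ball contains a piece of generation n + 1, whose mass
is comparable with r_n ^ t; between 4 r_n and w_n the bound of [nu_piece_part] is
linear in p and comparable with r_n ^ t for p = r_n. *)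
Lemma nu_lower_range : exists2 c1, 0 < c1 & forall om p, 0 <= om < 1 -> 0 < p < 1 ->
  ((c1 * p `^ t)%:E <= nu (ivl (phi om) p))%E.
Proof.
have Mp : 0 < M%:R :> R by rewrite ltr0n.
have M1 : 1 <= M%:R :> R by rewrite ler1n.
have mono n om p : 0 <= om < 1 -> w n <= p ->
    (((Q n)%:R^-1)%:E <= nu (ivl (phi om) p))%E.
  move=> om01 wp; apply: le_trans (nu_piece n om01) _.
  apply: le_measure; rewrite ?inE// => z; rewrite !ivlE; lra.
have MC : 0 < M%:R * C0 by rewrite mulr_gt0.
have [K K0 KE] : exists2 K, 0 < K & K = 4 * M%:R + 4 * (M%:R * C0).
  by eexists; last reflexivity; rewrite addr_gt0 ?mulr_gt0.
exists K^-1 => [|om p om01 /andP[p0 p1]]; first by rewrite invr_gt0.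
have pt0 : 0 < p `^ t by rewrite powR_gt0.
have [t0 t1] := andP t01.
have [wp|pw] := leP (w 0) p.
  apply: le_trans (mono _ _ _ om01 wp); rewrite lee_fin /= invr1.
  apply: mulr_ile1; rewrite ?invr_ge0 ?(ltW K0) ?(ltW pt0)//.
    by rewrite invf_le1//; lra.
  by rewrite -(powRr0 p) ger_powR// p0 ltW.
have [n /andP[wn1 wn]] := scale_index p0 pw.
have /andP[_ hd] := HD n.
have rt0 : 0 < r n `^ t by rewrite powR_gt0.
have [rp|pr] := leP (4 * r n) p.
  apply: le_trans (nu_piece_part om01 rp (ltW wn)); rewrite lee_fin.
  have rp' : r n <= p by have := r0 n; lra.
  have H := ler_powR_ratio (r0 n) rp' t01.
  have {}H : r n * p `^ t <= r n `^ t * p.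
    by move: H; rewrite ler_pdivrMr// mulrAC ler_pdivlMr.
  have Dn := D0 n; have rn := r0 n.
  have rD : 0 < 2 * r n * (D n)%:R by apply: mulr_gt0 => //; exact: mulr_gt0.
  rewrite ler_pdivlMr// -[X in X <= _]mulrA ler_pdivrMl//.
  apply: le_trans (_ : 2 * ((D n)%:R * r n `^ t) * p <= _).
    have -> : p `^ t * (2 * r n * (D n)%:R) = 2 * (D n)%:R * (r n * p `^ t) by ring.
    have -> : 2 * ((D n)%:R * r n `^ t) * p = 2 * (D n)%:R * (r n `^ t * p) by ring.
    by rewrite ler_pM2l// mulr_gt0.
  rewrite ler_pM2r//.
  have : C0 <= M%:R * C0 by rewrite ler_peMl// ltW.
  lra.
apply: le_trans (mono _ _ _ om01 wn1); rewrite lee_fin.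
rewrite /= -/(D n) natrM.
rewrite -[leRHS]mul1r ler_pdivlMr ?mulr_gt0// -[X in X <= _]mulrA ler_pdivrMl// mulr1.
have H : p `^ t <= 4 * r n `^ t.
  have : p `^ t <= (4 * r n) `^ t.
    by rewrite ge0_ler_powR// ?nnegrE ?mulr_ge0// ltW.
  rewrite powRM ?(ltW (r0 n))//;
      have : 4%:R `^ t <= 4%:R :> R by apply: ler1_powR => //; lra.
  nra.
have Dn := D0 n.
apply: le_trans (_ : 4 * M%:R * ((D n)%:R * r n `^ t) <= _); last first.
  have : 4 * M%:R * ((D n)%:R * r n `^ t) <= 4 * M%:R * C0
      by rewrite ler_pM2l ?mulr_gt0.
  lra.
have -> : 4 * M%:R * ((D n)%:R * r n `^ t) = 4 * r n `^ t * ((D n)%:R * M%:R) by ring.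
by rewrite ler_pM2r// mulr_gt0.
Qed.

Lemma nu_lower : exists2 c1, 0 < c1 & forall x p, coding_support x -> 0 < p < 1 ->
  ((c1 * p `^ t)%:E <= nu (ivl x p))%E.
Proof.
have [c1 c10 H] := nu_lower_range.
have [t0 t1] := andP t01.
exists (c1 * 2^-1 `^ t) => [|x p Kx /andP[p0 p1]]; first by rewrite mulr_gt0// powR_gt0.
have p2 : 0 < p / 2 by rewrite divr_gt0.
have [om [om01 xom]] := coding_support_approx Kx p2.
have p21 : 0 < p / 2 < 1 by apply/andP; split; lra.
have := H om (p / 2) om01 p21.
rewrite powRM ?(ltW p0)// mulrA mulrAC => /le_trans; apply.
apply: le_measure; rewrite ?inE//.
by rewrite {2}(splitr p); apply: ivl_sub; exact: ltW.
Qed.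

(** At the scale of the pieces the mass is as large as the exponent s allows. *)
Lemma nu_lower_w : exists2 c1, 0 < c1 & forall n x, coding_support x ->
  ((c1 * (2 * w n) `^ s)%:E <= nu (ivl x (2 * w n)))%E.
Proof.
have s2 : 0 < 2%:R `^ s :> R by rewrite powR_gt0.
exists (C0 * 2%:R `^ s)^-1 => [|n x Kx]; first by rewrite invr_gt0 mulr_gt0.
have [om [om01 xom]] := coding_support_approx Kx (w0 n).
apply: (@le_trans _ _ (nu (ivl (phi om) (w n)))); last first.
  apply: le_measure; rewrite ?inE// mulr2n mulrDl mul1r.
  by apply: ivl_sub; exact: ltW.
apply: le_trans (nu_piece n om01); rewrite lee_fin.
have /andP[_ hq] := HQ n.
rewrite powRM ?(ltW (w0 n))// -[leRHS]mul1r ler_pdivlMr//.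
rewrite -[X in X <= _]mulrA ler_pdivrMl ?mulr_gt0// mulr1.
have -> : 2 `^ s * w n `^ s * (Q n)%:R = (Q n)%:R * w n `^ s * 2 `^ s by ring.
by rewrite ler_pM2r.
Qed.

End cantor_measure.

(** * The digit zero and annuli on the line *)

Lemma sum_neq0 (M : nat) : (\sum_(0 <= i < M) (i != 0%N))%N = M.-1.
Proof.
case: M => [|M]; first by rewrite big_geq.
rewrite big_nat_recl//= add0n (eq_bigr (fun=> 1%N))//.
by rewrite sum_nat_const_nat subn0 muln1.
Qed.

Section zero_digits.
Context {R : realType}.
Variables (M : nat) (N : nat -> nat) (w : nat -> R).
Hypothesis M2 : (1 < M)%N.
Hypothesis N0 : forall n, (0 < N n)%N.
Hypothesis w0 : forall n, 0 < w n.
Hypothesis wS : forall n, M%:R * w n.+1 <= cellw N w n / 12%:R.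
Variable nu : probability (measurableTypeR R) R.
Local Notation phi := (coding M N w).
Hypothesis nuE : forall A, measurable A -> nu A = unif01 R (phi @^-1` A).

Let M0 : (0 < M)%N. Proof. exact: ltnW. Qed.

(** Probability that a digit is not 0, and share of a cell in its last M - 1 pieces. *)
Definition nonzero_ratio : R := (M.-1)%:R / M%:R.

Lemma nonzero_ratio_bounds : 0 <= nonzero_ratio < 1.
Proof.
by rewrite /nonzero_ratio divr_ge0//= ltr_pdivrMr ?ltr0n// mul1r ltr_nat prednK.
Qed.

Lemma unif01_nonzero_digit n (P : pred nat) :
  unif01 R [set om | P (cidx M N n om) && (pidx M N n.+1 om %% M != 0)%N] =
  (unif01 R [set om | P (cidx M N n om)] * nonzero_ratio%:E)%E.
Proof.
rewrite /nonzero_ratio -(sum_neq0 M) -unif01_digit ?cells_gt0//.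
by congr (unif01 R _); apply/funext => om; rewrite /= -(pidxS_div N M2).
Qed.

(** As a predicate on the index of a piece of generation m + k: the digits of the
generations m + 1, ..., m + k are all different from 0. *)
Fixpoint zero_free m k : pred nat :=
  if k is k'.+1 then
    [pred j | zero_free m k' (j %/ M %/ N (m + k'))%N && (j %% M != 0)%N]
  else xpredT.

Lemma zero_freeP m k (om : R) : (forall n, (m <= n)%N ->
    (pidx M N n.+1 om %% M != 0)%N) ->
  zero_free m k (pidx M N (m + k) om).
Proof.
move=> H; elim: k => [|k ih] //=.
by rewrite addnS pidxS_div// cidx_div// ih H// leq_addr.
Qed.

Lemma unif01_zero_free m k :
  unif01 R [set om : R | zero_free m k (pidx M N (m + k) om)] = (nonzero_ratio ^+ k)%:E.
Proof.
elim: k => [|k ih].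
  rewrite expr0 -(@probability_setT _ _ _ (unif01 R)).
  by congr (unif01 R _); apply/seteqP.
rewrite exprSr EFinM -ih.
rewrite (_ : [set om : R | zero_free m k (pidx M N (m + k) om)] =
  [set om : R | [pred c | zero_free m k (c %/ N (m + k))%N] (cidx M N (m + k)
      om)]); last first.
  by apply/funext => om /=; rewrite cidx_div.
rewrite -unif01_nonzero_digit; congr (unif01 R _); apply/funext => om /=.
by rewrite addnS pidxS_div.
Qed.

(** The pieces of digit 0 of generation n + 1, enlarged from coded points to whole
intervals, so that measurability is plain; [zero_digit_annulus] holds at all their
points, even outside the Cantor set. *)
Definition zero_digit_zone n : set (measurableTypeR R) :=
  \bigcup_c `[cell M N w n c, cell M N w n c + w n.+1]%classic.

Lemma measurable_zero_digit_zone n : measurable (zero_digit_zone n).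
Proof. by apply: bigcupT_measurable => c; exact: measurable_itv. Qed.

Lemma coding_zero_digit n om : (pidx M N n.+1 om %% M)%N = 0%N ->
    zero_digit_zone n (phi om).
Proof.
move=> e; exists (cidx M N n om) => //=; rewrite in_itv/=.
have := coding_in_piece M2 N0 w0 wS n.+1 om.
by rewrite pieceS e /digit_off eqxx addr0 pidxS_div.
Qed.

(** Independence of the digits gives the probability (1 - 1/M)^k to the event that k
given generations have a digit different from 0; it tends to 0. *)
Lemma nu_zero_digit_often : nu (lim_sup_set zero_digit_zone) = 1%E.
Proof.
have mT : measurable (lim_sup_set zero_digit_zone).
  apply: bigcapT_measurable => n; apply: bigcup_measurable => k _.
  exact: measurable_zero_digit_zone.
suff H : nu (~` lim_sup_set zero_digit_zone) = 0%E.
  by have := probability_setC nu (measurableC mT); rewrite setCK H sube0.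
rewrite /lim_sup_set setC_bigcap.
have mB m : measurable (~` (\bigcup_(j >= m) zero_digit_zone j)).
  by apply: measurableC; apply: bigcup_measurable => k _;
      exact: measurable_zero_digit_zone.
apply/eqP; rewrite eq_le measure_ge0 andbT.
have /negligibleP H : nu.-negligible (\bigcup_m ~` (\bigcup_(j >= m)
    zero_digit_zone j)).
  apply: negligible_bigcup => m; apply/negligibleP => //.
  apply/eqP; rewrite eq_le measure_ge0 andbT.
  have le k : (nu (~` \bigcup_(j >= m) zero_digit_zone j) <= (nonzero_ratio ^+ k)%:E)%E.
    rewrite nuE// -(unif01_zero_free m k); apply: le_measure; rewrite ?inE.
    - exact: (measurable_coding_pre M2 N0 w0 wS (mB m)).
    - exact: measurable_truncn_pred.
    move=> om /= nsp; apply: zero_freeP => n mn; apply/eqP => e; apply: nsp.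
    by exists n => //; exact: coding_zero_digit.
  apply/lee_addgt0Pr => e e0; rewrite add0e.
  have /andP[k0 k1] := nonzero_ratio_bounds.
  have : nonzero_ratio ^+ n @[n --> \oo] --> (0 : R) by apply: cvg_expr;
      rewrite ger0_norm.
  move=> /cvgr0Pnorm_lt/(_ e e0)[n _ /(_ n (leqnn n))] /ltW kn.
  apply: le_trans (le n) _; rewrite lee_fin; apply: le_trans kn; exact: ler_norm.
by rewrite H//; exact: bigcupT_measurable.
Qed.

(** The radius p is the distance from x to the end of the last piece of the cell c. The
interval of radius p around x does not reach the pieces of the neighbouring cells,
and its right end part of length p ^ delta contains the last M - 1 pieces of c. *)
Lemma zero_digit_annulus n (x delta : R) : zero_digit_zone n x -> 1 <= delta ->
    cellw N w n <= 1 ->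
  M%:R * w n.+1 <= (cellw N w n / 4) `^ delta ->
  exists p, [/\ 0 < p, p <= cellw N w n &
    (nonzero_ratio%:E * nu (ivl x p) <= nu (ivl x p `\` ivl x (p - p `^ delta)))%E].
Proof.
move=> [c _] /=; rewrite in_itv/= => /andP[x1 x2] d1 r1 Hann.
set r := cellw N w n in r1 Hann *; set a := cell M N w n c in x1 x2.
have r0 : 0 < r by exact: cellw_gt0.
have wr : w n.+1 <= r / 24 by exact: (wS_le M2 w0 wS).
have w10 := w0 n.+1.
(* The right end of the last piece of the cell c is a + r / 3. *)
set p := a + r / 3 - x; exists p.
have p4 : r / 4 <= p by rewrite /p; lra.
have p0 : 0 < p by lra.
have p1 : p <= r / 3 by rewrite /p; lra.
have pd : (r / 4) `^ delta <= p `^ delta.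
  have r4 : 0 <= r / 4 by rewrite divr_ge0// ltW.
  by rewrite ge0_ler_powR ?nnegrE ?(le_trans _ d1) ?(ltW p0).
have pdp : p `^ delta <= p by apply: ge1r_powR => //; rewrite p0; lra.
split => //; first lra.
have mI : measurable (ivl x p) by exact: measurable_itv.
have mI' : measurable (ivl x (p - p `^ delta)) by exact: measurable_itv.
have mD : measurable (ivl x p `\` ivl x (p - p `^ delta)) by exact: measurableD.
pose P : pred nat := pred1 c.
apply: (@le_trans _ _ (nonzero_ratio%:E * unif01 R [set om | P (cidx M N n om)])%E).
  apply: lee_wpmul2l; first by rewrite lee_fin; case/andP: nonzero_ratio_bounds.
  rewrite nuE//; apply: le_measure; rewrite ?inE.
  - exact: (measurable_coding_pre M2 N0 w0 wS mI).
  - exact: measurable_truncn_pred.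
  move=> om /=; rewrite ivlE /P; move=> /andP[y1 y2].
  have /andP[h1 h2] := coding_in_cell M2 N0 w0 wS n om.
  rewrite -/r in h1 h2.
  have cs := cell_step M2 N0 w0 wS n; rewrite -/r in cs.
  case: (ltngtP (cidx M N n om) c) => [ltc|gtc|->]; last exact: eqxx.
    have := step_lt_le (ltW r0) cs ltc; move: y1 y2; rewrite /p -/a; lra.
  have := step_lt_le (ltW r0) cs gtc; move: y1 y2; rewrite /p -/a; lra.
rewrite muleC -unif01_nonzero_digit nuE//; apply: le_measure; rewrite ?inE.
- rewrite (_ : mkset _ = [set om : R | [pred j | P (j %/ M)%N && (j %% M != 0)%N]
      (pidx M N n.+1 om)]); first exact: measurable_truncn_pred.
  by apply/funext => om /=; rewrite pidxS_div.
- exact: (measurable_coding_pre M2 N0 w0 wS mD).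
move=> om /= /andP[/eqP cc dig].
have /andP[h1 h2] := coding_in_cell M2 N0 w0 wS n om.
have /andP[h3 h4] := coding_in_piece M2 N0 w0 wS n.+1 om.
rewrite cc -/r -/a in h1 h2.
rewrite pieceS pidxS_div// cc -/a /digit_off (negbTE dig) -/r in h3.
have : (M - pidx M N n.+1 om %% M)%:R <= M%:R - 1 :> R.
  by rewrite lerBrDr natr1 ler_nat ltn_subrL lt0n dig M0.
move=> Mi; have Mw : (M - pidx M N n.+1 om %% M)%:R * w n.+1 <= M%:R * w n.+1 - w n.+1.
  by rewrite -[X in _ - X]mul1r -mulrBl ler_pM2r.
rewrite !ivlE; split; first by move: p0 pdp pd; rewrite /p; lra.
by move: p0 pdp pd; rewrite /p; lra.
Qed.

End zero_digits.

(** * Choice of the numbers of cells and of the lengths of the pieces *)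

Section scheme_choice.
Context {R : realType}.
Variables (M : nat) (s t : R).
Hypothesis M2 : (1 < M)%N.
Hypothesis s0 : 0 < s.
Hypothesis st : s < t.
Hypothesis t1 : t < 1.
Let delta := t / s.

Let t0 : 0 < t. Proof. exact: lt_trans st. Qed.
Let delta1 : 1 < delta. Proof. by rewrite /delta ltr_pdivlMr// mul1r. Qed.
Let M2' : 2 <= M%:R :> R. Proof. by rewrite ler_nat. Qed.
Let Mp : 0 < M%:R :> R. Proof. by rewrite ltr0n ltnW. Qed.

(** The initial length W has to be small for two reasons: the pieces fit in their cells
if r_n ^ (delta - 1) is small, and the number of cells of a piece has to be at
least 1 before it is rounded. *)
Lemma small_width : exists W : R, [/\ 0 < W < 1, W `^ (t - s) * (2 * M%:R) <= 1 &
  W `^ (delta - 1) <= 3^-1].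
Proof.
(* With W = (4 M)^(-1/e), both powers are at most W^e = 1 / (4 M) <= 1/8. *)
pose e := Num.min (t - s) (delta - 1).
have e0 : 0 < e by rewrite lt_min !subr_gt0 st.
pose b : R := (4 * M%:R)^-1.
have b0 : 0 < b by rewrite invr_gt0 mulr_gt0.
have b8 : b <= 8^-1.
  by rewrite lef_pV2 ?posrE ?mulr_gt0//; move: M2'; lra.
have bM : b * (2 * M%:R) = 2^-1 by rewrite /b; field; rewrite gt_eqF.
have We : (b `^ e^-1) `^ e = b by rewrite -powRrM mulVf ?gt_eqF// powRr1// ltW.
have W0 : 0 < b `^ e^-1 by rewrite powR_gt0.
have W1 : b `^ e^-1 < 1.
  rewrite -[ltRHS](_ : 1 `^ e^-1 = 1); last by rewrite powR1.
  by apply: (@gt0_ltr_powR _ e^-1) => //; rewrite ?invr_gt0 ?nnegrE ?(ltW b0)//; lra.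
have le x : e <= x -> (b `^ e^-1) `^ x <= b.
  by move=> ex; rewrite -[leRHS]We ger_powR// W0 ltW.
have l1 : (b `^ e^-1) `^ (t - s) <= b by apply: le; rewrite ge_min lexx.
have l2 : (b `^ e^-1) `^ (delta - 1) <= b by apply: le; rewrite ge_min lexx orbT.
exists (b `^ e^-1); split; first by rewrite W0.
  apply: le_trans (_ : b * (2 * M%:R) <= _); last by rewrite bM; lra.
  by rewrite ler_pM2r// mulr_gt0.
by apply: le_trans l2 _; lra.
Qed.

(** The real solution X of Q X (w / X) ^ t = 1, rounded up: cells have mass comparable
with the power t of their length. *)
Definition next_cut (Qw : nat * R) : nat :=
  (Num.truncn ((Qw.2 `^ t * Qw.1%:R)^-1 `^ (1 - t)^-1)).+1.

Definition next_state (Qw : nat * R) : nat * R :=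
  let N := next_cut Qw in
  ((Qw.1 * N * M)%N, (Qw.2 / N%:R / 4) `^ delta / M%:R).

(** One step of the construction. Rounding multiplies X by at most 2, hence
Q N r ^ t, equal to 1 for X, by a factor between 1 and 2; the exact choice of the
new length then makes the bounds on Q w ^ s depend only on M, whatever they were
before. This is why errors
do not build up from a generation to the next one. *)
Lemma next_stateP (W : R) (Q : nat) (w : R) :
  0 < W < 1 -> W `^ (t - s) * (2 * M%:R) <= 1 -> W `^ (delta - 1) <= 3^-1 ->
  (0 < Q)%N -> 0 < w <= W -> Q%:R * w `^ s <= 2 * M%:R ->
  let N := next_cut (Q, w) in
  let Q' := (next_state (Q, w)).1 in
  let w' := (next_state (Q, w)).2 in
  let r := w / N%:R in
  [/\ 1 <= (Q * N)%:R * r `^ t <= 2, M%:R * w' <= r / 12,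
      0 < w' <= W & 4^-1 <= Q'%:R * w' `^ s <= 2 * M%:R].
Proof.
move=> /andP[W0 W1] Wts Wd Q0 /andP[w0 wW] Qw /=; set N := next_cut (Q, w).
have Q0' : 0 < Q%:R :> R by rewrite ltr0n.
have w1 : w <= 1 by lra.
have t1' : 0 < 1 - t by rewrite subr_gt0.
have s0' := s0; have st' := st; have t1'' := t1.
have M2'' := M2'; have t0' := t0; have delta1' := delta1; have Mp' := Mp.
have wt0 : 0 < w `^ t by rewrite powR_gt0.
pose Y : R := (w `^ t * Q%:R)^-1.
have Y1 : 1 <= Y.
  rewrite /Y invf_ge1 ?mulr_gt0//.
  have -> : w `^ t = w `^ (t - s) * w `^ s by rewrite -powRD ?subrK// gt_eqF// implybT.
  rewrite -mulrA [w `^ s * _]mulrC; apply: le_trans Wts.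
  apply: ler_pM; rewrite ?mulr_ge0 ?powR_ge0//.
  by apply: ge0_ler_powR; rewrite ?nnegrE ?subr_ge0 ?(ltW st') ?(ltW w0) ?(ltW W0).
have YE : Q%:R * w `^ t * Y = 1
    by rewrite mulrC [Q%:R * _]mulrC mulVf// gt_eqF// mulr_gt0.
pose X := Y `^ (1 - t)^-1.
have X1 : 1 <= X.
  rewrite /X -[leLHS](powRr0 Y) ler_powR// invr_ge0 ltW//.
have XE : X `^ (1 - t) = Y by rewrite -powRrM mulVf ?gt_eqF// powRr1//; lra.
have XN : X <= N%:R by apply: ltW; exact: truncnS_gt.
have NX : N%:R <= 2 * X.
  have : (Num.truncn X)%:R <= X by rewrite truncn_le; lra.
  rewrite /N /next_cut -/Y -/X -natr1; lra.
have N0 : 0 < N%:R :> R by lra.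
have r0 : 0 < w / N%:R by rewrite divr_gt0.
have Nt0 : 0 < N%:R `^ t :> R by rewrite powR_gt0.
have Npow : (Q * N)%:R * (w / N%:R) `^ t = Q%:R * w `^ t * N%:R `^ (1 - t).
  rewrite natrM powRM ?invr_ge0 ?(ltW w0) ?(ltW N0)//.
  have -> : (N%:R^-1 : R) `^ t = (N%:R `^ t)^-1.
    by rewrite -powR_inv1 ?(ltW N0)// -powRrM mulN1r powRN.
  rewrite powRB ?gt_eqF ?implybT// powRr1 ?(ltW N0)//; ring.
have D1 : 1 <= (Q * N)%:R * (w / N%:R) `^ t <= 2.
  have le1 : Y <= N%:R `^ (1 - t).
    by rewrite -XE; apply: ge0_ler_powR; rewrite ?nnegrE//; lra.
  have le2 : N%:R `^ (1 - t) <= 2 * Y.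
    apply: le_trans (_ : (2 * X) `^ (1 - t) <= _).
      by apply: ge0_ler_powR; rewrite ?nnegrE//; lra.
    rewrite powRM ?XE//; last lra.
    rewrite ler_pM2r; last lra.
    by apply: ler1_powR => //; lra.
  have QW : 0 < Q%:R * w `^ t by rewrite mulr_gt0.
  rewrite Npow; apply/andP; split.
    by apply: le_trans (_ : Q%:R * w `^ t * Y <= _); [rewrite YE|rewrite ler_pM2l].
  apply: le_trans (_ : Q%:R * w `^ t * (2 * Y) <= _); first by rewrite ler_pM2l.
  by rewrite mulrCA YE mulr1.
have rw : w / N%:R <= w by rewrite ler_pdivrMr// ler_peMr ?(ltW w0)//; lra.
have r4 : 0 < w / N%:R / 4 by rewrite divr_gt0.
have r4d0 : 0 < (w / N%:R / 4) `^ delta by rewrite powR_gt0.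
have rd : (w / N%:R / 4) `^ delta <= w / N%:R / 12.
  have -> : (w / N%:R / 4) `^ delta = w / N%:R / 4 * (w / N%:R / 4) `^ (delta - 1).
    by rewrite mulr_powRB1 ?(ltW r4)//; lra.
  have -> : w / N%:R / 12 = w / N%:R / 4 * 3^-1 by lra.
  rewrite ler_pM2l//; apply: le_trans Wd.
  have r4W : w / N%:R / 4 <= W by lra.
  by apply: ge0_ler_powR; rewrite ?nnegrE ?subr_ge0 ?(ltW delta1') ?(ltW r4) ?(ltW W0).
have w'E : M%:R * ((w / N%:R / 4) `^ delta / M%:R) = (w / N%:R / 4) `^ delta.
  by rewrite mulrC divfK// gt_eqF.
split => //.
- by rewrite w'E.
- rewrite divr_gt0//= ler_pdivrMr//.
  apply: le_trans rd _; apply: le_trans (_ : W * 1 <= _); first by rewrite mulr1; lra.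
  by rewrite ler_pM2l//; lra.
have -> : (Q * N * M)%:R * ((w / N%:R / 4) `^ delta / M%:R) `^ s =
    (Q * N)%:R * (w / N%:R) `^ t * (4^-1 `^ t * M%:R `^ (1 - s)).
  rewrite [(Q * N * M)%:R]natrM powRM ?invr_ge0 ?(ltW Mp) ?(ltW r4d0)//.
  rewrite -powRrM /delta divfK ?gt_eqF//.
  have -> : (M%:R^-1 : R) `^ s = (M%:R `^ s)^-1.
    by rewrite -powR_inv1 ?(ltW Mp)// -powRrM mulN1r powRN.
  rewrite [(w / N%:R / 4) `^ t]powRM ?(ltW r0)//.
  rewrite powRB ?(gt_eqF Mp') ?implybT// powRr1 ?(ltW Mp)//; ring.
have q1 : 4^-1 <= (4^-1 : R) `^ t.
  by apply: ger1_powR; rewrite ?(ltW t1)//; lra.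
have q2 : (4^-1 : R) `^ t <= 1.
  by rewrite -[leRHS](powRr0 (4^-1 : R)); apply: ger_powR; rewrite ?(ltW t0)//; lra.
have m1 : 1 <= M%:R `^ (1 - s) :> R.
  rewrite -[leLHS](powRr0 (M%:R : R)); apply: ler_powR; first by rewrite ler1n ltnW.
  by rewrite subr_ge0 (ltW (lt_trans st' t1'')).
have m2 : M%:R `^ (1 - s) <= M%:R :> R.
  by apply: ler1_powR; rewrite ?ler1n 1?ltnW// gerBl ltW.
case/andP: D1 => D1 D2.
apply/andP; split.
  rewrite -[leLHS]mul1r; apply: ler_pM => //.
  by rewrite -[leLHS]mulr1; apply: ler_pM.
apply: ler_pM => //; rewrite ?mulr_ge0 ?powR_ge0 ?(le_trans _ D1)//.
by rewrite -[leRHS]mul1r; apply: ler_pM; rewrite ?powR_ge0.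
Qed.

Lemma scheme_exists : exists N : nat -> nat, exists w : nat -> R, exists c C : R,
  [/\ [/\ 0 < c, 0 < C & w 0 < 1], forall n, (0 < N n)%N, forall n, 0 < w n,
      forall n, M%:R * w n.+1 <= cellw N w n / 12 &
   [/\ forall n, M%:R * w n.+1 <= (cellw N w n / 4) `^ delta,
      forall n, c <= (pieces M N n)%:R * w n `^ s <= C &
      forall n, c <= (cells M N n)%:R * cellw N w n `^ t <= C]].
Proof.
have M2'' := M2'; have [W [W01 Wts Wd]] := small_width; have /andP[W0 W1] := W01.
pose sq n := iter n next_state (1%N, W).
pose N n := next_cut (sq n); pose w n := (sq n).2.
have Ws1 : W `^ s <= 1.
  by rewrite -[leRHS](powRr0 W) ger_powR ?(ltW s0)// W0 ltW.
have Ws0 : 0 < W `^ s by rewrite powR_gt0.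
have N0 n : (0 < N n)%N by [].
have pE n : pieces M N n = (sq n).1.
  by elim: n => // n ih; rewrite [LHS]/= ih.
have inv n : [/\ (0 < (sq n).1)%N, 0 < w n <= W & (sq n).1%:R * w n `^ s <= 2 * M%:R].
  elim: n => [|n [Qn wn Qwn]].
    rewrite /= W0 lexx mul1r; split => //; lra.
  have := next_stateP W01 Wts Wd Qn wn Qwn.
  rewrite /w /sq iterS -/(sq n) -surjective_pairing => -[_ _ -> /andP[_ ->]].
  by rewrite !muln_gt0 Qn (ltnW M2).
have stepn n := let: And3 Qn wn Qwn := inv n in
  next_stateP W01 Wts Wd Qn wn Qwn.
exists N, w, (4^-1 * W `^ s), (2 * M%:R).
have le4 : 4^-1 * W `^ s <= 4^-1 by rewrite ler_piMr.
split.
- by rewrite !mulr_gt0 ?invr_gt0.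
- exact: N0.
- by move=> n; have [_ /andP[]] := inv n.
- move=> n; have := stepn n; rewrite -surjective_pairing => -[_ H _ _].
  exact: H.
split.
- move=> n; rewrite /w /sq iterS -/(sq n) /next_state /= mulrC divfK ?gt_eqF//.
- case=> [|n]; first by rewrite /= mul1r {2}/w /= /w /=; apply/andP; split; lra.
  rewrite pE; have := stepn n; rewrite -surjective_pairing => -[_ _ _ /andP[H1 H2]].
  by rewrite /w /sq iterS -/(sq n) H2 andbT (le_trans le4).
move=> n; rewrite /cells pE; have := stepn n.
rewrite -surjective_pairing => -[/andP[H1 H2] _ _ _].
rewrite /cellw -/(w n) in H1 H2 *; apply/andP; split.
  by apply: le_trans H1; lra.
by apply: le_trans H2 _; lra.
Qed.

End scheme_choice.

(** * The measure on the line *)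

Lemma cvg0_le_geometric (R : realType) (u : nat -> R) (a : R) :
  (forall n, 0 <= u n <= a / 2 ^+ n) -> u n @[n --> \oo] --> (0 : R).
Proof.
move=> ua; apply: (@squeeze_cvgr _ _ _ _ (fun=> 0) (fun n => a / 2 ^+ n)).
- by apply: nearW => n; exact: ua.
- exact: cvg_cst.
have -> : (fun n => a / 2 ^+ n) = geometric a (2^-1 : R).
  by apply/funext => n; rewrite /geometric /= exprVn.
by apply: cvg_geometric; rewrite ger0_norm ?invf_lt1// ltr1n.
Qed.

(** The scales [u] and [v] are those at which the exponents s and t are attained. They
are the same for all points of K. *)
Lemma two_scale_measure (R : realType) (s t eta : R) :
  0 < s -> s < t -> t < 1 -> eta < 1 ->
  exists (nu : probability (measurableTypeR R) R) (K G : set (measurableTypeR R))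
    (c C : R) (u v : nat -> R),
  [/\ [/\ 0 < c, 0 < C, forall n, 0 < u n /\ 0 < v n,
        u n @[n --> \oo] --> (0 : R) & v n @[n --> \oo] --> (0 : R)],
    compact (K : set R) /\ nu K = 1%E,
    (forall x p, 0 < p < 1 -> (nu (ivl x p) <= (C * p `^ s)%:E)%E) /\
    (forall n x, (nu (ivl x (v n)) <= (C * v n `^ t)%:E)%E),
    (forall x p, K x -> 0 < p < 1 -> ((c * p `^ t)%:E <= nu (ivl x p))%E) /\
    (forall n x, K x -> ((c * u n `^ s)%:E <= nu (ivl x (u n)))%E) &
    [/\ measurable G, nu G = 1%E & forall x e, G x -> 0 < e ->
      exists p, [/\ 0 < p, p < e & (eta%:E * nu (ivl x p) <=
        nu (ivl x p `\` ivl x (p - p `^ (t / s))))%E]]].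
Proof.
move=> s0 st t1 eta1.
(* M is chosen with 1 / M <= 1 - eta, that is, eta <= 1 - 1 / M. *)
pose M := (Num.truncn ((1 - eta)^-1)).+2.
have M2 : (1 < M)%N by [].
have Mp : 0 < M%:R :> R by rewrite ltr0n.
have keepM : eta <= nonzero_ratio M :> R.
  have : (1 - eta)^-1 < M%:R.
    by apply: lt_trans (truncnS_gt _) _; rewrite ltr_nat.
  have e0 : 0 < 1 - eta by rewrite subr_gt0.
  rewrite -[X in X < _]mul1r ltr_pdivrMr// => H.
  rewrite /nonzero_ratio ler_pdivlMr// -[M.-1]/(Num.truncn ((1 - eta)^-1)).+1.
  have -> : (Num.truncn (1 - eta)^-1).+1%:R = M%:R - 1 :> R.
    by rewrite /M -[in RHS]natr1 addrK.
  by move: H; lra.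
have [N [w [c0 [C0 [[c00 C00 w1] N0 w0 wS [Hann HQ HD]]]]]] :=
    scheme_exists M2 s0 st t1.
pose phi : measurableTypeR R -> measurableTypeR R := coding M N w.
have mphi : measurable_fun setT phi.
  by apply: nondecreasing_measurable => //; exact: coding_nd.
have [nu nuE] := pushforward_probability (unif01 R) mphi.
have s01 : 0 <= s <= 1 by rewrite (ltW s0) ltW// (lt_trans st).
have t01 : 0 <= t <= 1 by rewrite (ltW t1) ltW// (lt_trans s0).
have [C1 C10 up] := nu_upper M2 N0 w0 wS s01 c00 HQ nuE.
have up' := nu_upper_cellw M2 N0 w0 wS c00 HD nuE.
have [c1 c10 lo] := nu_lower M2 N0 w0 wS t01 C00 HD nuE.
have [c2 c20 lo'] := nu_lower_w M2 N0 w0 wS C00 HQ nuE.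
pose K : set R := coding_support M N w.
pose G := lim_sup_set (zero_digit_zone M N w).
have r0 := cellw_gt0 N0 w0.
have rw := cellw_le N0 w0.
have wle := w_le M2 N0 w0 wS.
exists nu, K, G, (Num.min c1 c2), (Num.max C1 (8 / c0)),
  (fun n => 2 * w n), (cellw N w).
have cK : closed K by exact: closed_closure.
have mK : measurable (K : set (measurableTypeR R)) by exact: closed_measurable.
have mG : measurable G.
  apply: bigcapT_measurable => n; apply: bigcup_measurable => k _.
  exact: measurable_zero_digit_zone.
split.
- split.
  + by rewrite lt_min c10.
  + by rewrite lt_max C10.
  + by move=> n; rewrite mulr_gt0.
  + apply: (@cvg0_le_geometric _ _ (2 * w 0%N)) => n.
    by rewrite mulr_ge0 ?(ltW (w0 n))//= -mulrA ler_pM2l.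
  + apply: (@cvg0_le_geometric _ _ (w 0%N)) => n.
    by rewrite ltW//= (le_trans (rw n)).
- split.
    apply: (subclosed_compact cK (@segment_compact _ 0 1)).
    have /closure_id -> : closed (`[0, 1]%classic : set R) by exact: itv_closed.
    apply: closureS => _ [om /= /andP[om0 om1] <-].
    have := coding_in_piece M2 N0 w0 wS 0 om.
    have -> : pidx M N 0 om = 0%N by apply/truncn0Pn; rewrite mulr1 -ltNge.
    rewrite /= mul0r add0r in_itv/= => /andP[-> /le_trans->//]; exact: ltW.
  apply/eqP; rewrite eq_le probability_le1//= nuE//.
  have := @unif01_ge R (phi @^-1` K) 0 1; rewrite subr0; apply => //.
    by rewrite -[X in measurable X]setTI; exact: mphi.
  move=> y /andP[y0 y1]; apply: subset_closure; exists y => //=.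
  by rewrite y1 ltW.
- split.
    move=> x p p01; apply: le_trans (up x p p01) _.
    by rewrite lee_fin ler_wpM2r ?powR_ge0// le_max lexx.
  move=> n x; apply: le_trans (up' n x) _.
  by rewrite lee_fin ler_wpM2r ?powR_ge0// le_max lexx orbT.
- split.
    move=> x p Kx p01; apply: le_trans (lo x p Kx p01).
    by rewrite lee_fin ler_wpM2r ?powR_ge0// ge_min lexx.
  move=> n x Kx; apply: le_trans (lo' n x Kx).
  by rewrite lee_fin ler_wpM2r ?powR_ge0// ge_min lexx orbT.
split=> //; first exact: nu_zero_digit_often nuE.
move=> x e Gx e0.
have [m wm] := w_small M2 N0 w0 wS e0.
have [n /= mn Sx] := Gx m I.
have wmn : w n <= w m.
  elim: n mn {Sx} => [|n ih]; first by rewrite leqn0 => /eqP->.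
  rewrite leq_eqVlt => /orP[/eqP->//|/ih]; apply: le_trans.
  by have := wS_half M2 N0 w0 wS n; have := w0 n; lra.
have w0n : w n <= w 0%N.
  by apply: le_trans (wle n) _;
      rewrite ler_pdivrMr ?exprn_gt0// ler_peMr ?(ltW (w0 _))// exprn_ege1// ler1n.
have d1 : 1 <= t / s by rewrite ler_pdivlMr// mul1r ltW.
have r1 : cellw N w n <= 1 by apply: le_trans (rw n) _; lra.
have [p [p0 pr H]] := zero_digit_annulus M2 N0 w0 wS nuE Sx d1 r1 (Hann n).
exists p; split => //.
  by apply: le_lt_trans pr _; apply: le_lt_trans (rw n) _; apply: le_lt_trans wm.
by apply: le_trans H; apply: lee_wpmul2r => //; rewrite lee_fin.
Qed.

(** * Borel sets and product probabilities on row vectors *)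

Lemma rV_normP (R : realType) n (y : 'rV[R]_n) (r : R) : 0 <= r ->
  `|y| <= r <-> forall i, `|y 0 i| <= r.
Proof.
move=> r0; rewrite [`|y|]/Num.Def.normr /= mx_normrE; split=> [/bigmax_leP[_ H] i|H].
  exact: (H (0, i)).
by apply/bigmax_leP; split => // -[i j] _ /=; rewrite ord1.
Qed.

Lemma rV_norm_ltP (R : realType) n (y : 'rV[R]_n) (r : R) : 0 < r ->
  `|y| < r <-> forall i, `|y 0 i| < r.
Proof.
move=> r0; rewrite [`|y|]/Num.Def.normr /= mx_normrE; split=> [/bigmax_ltP[_ H] i|H].
  exact: (H (0, i)).
by apply/bigmax_ltP; split => // -[i j] _ /=; rewrite ord1.
Qed.

(** Cubes are boxes: the measurability of a box and its mass for a product
probability reduce to the coordinates. *)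
Definition box (R : realType) n (A : 'I_n -> set (measurableTypeR R)) :
    set (borel_rV R n) :=
  [set y : 'rV[R]_n | forall i, A i (y 0 i)].

Lemma cball_coord (R : realType) n (x : 'rV[R]_n) (r : R) : 0 <= r ->
  cball x r = box (fun i => ivl (x 0 i) r).
Proof.
move=> r0; apply/seteqP; split => y; rewrite /cball /closed_ball_ /=.
  move=> /(rV_normP _ r0) H i; have := H i; rewrite !mxE ivlE ler_norml; lra.
move=> H; apply/(rV_normP _ r0) => i; have := H i; rewrite !mxE ivlE ler_norml; lra.
Qed.

Lemma measurable_open_rV (R : realType) n (U : set (borel_rV R n)) :
  open (U : set 'rV[R]_n) -> measurable U.
Proof. exact: sub_sigma_algebra. Qed.

Lemma measurable_closed_rV (R : realType) n (U : set (borel_rV R n)) :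
  closed (U : set 'rV[R]_n) -> measurable U.
Proof.
move=> cU; rewrite -[U]setCK; apply: measurableC.
by apply: measurable_open_rV; exact: closed_openC.
Qed.

Lemma measurable_coord (R : realType) n (i : 'I_n) :
  measurable_fun setT (fun v : borel_rV R n => v 0 i : measurableTypeR R).
Proof.
apply: (measurability (@RGenOInfty.G R)) => [|/= _ [_] [r] -> <-].
  exact: RGenOInfty.measurableE.
rewrite setTI; apply: measurable_open_rV.
have -> : (fun v : 'rV[R]_n => v 0 i) @^-1` `]r, +oo[%classic =
    (fun v : 'rV[R]_n => v 0 i) @^-1` [set x | x > r].
  by apply/seteqP; split => x /=; rewrite in_itv/= andbT.
by apply: open_comp; [move=> x _; exact: coord_continuous|exact: open_gt].
Qed.

Lemma measurable_box (R : realType) n (A : 'I_n -> set (measurableTypeR R)) :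
  (forall i, measurable (A i)) ->
  measurable (box A).
Proof.
move=> mA; have -> : box A =
    \bigcap_(i in [set: 'I_n]) ((fun v : borel_rV R n => v 0 i) @^-1` A i).
  by apply/seteqP; split => y /= H i; [move=> _; exact: H|exact: H].
apply: fin_bigcap_measurable; first exact: finite_finset.
by move=> i _; rewrite -[X in measurable X]setTI; exact: measurable_coord.
Qed.

Lemma measurable_cball (R : realType) n (x : 'rV[R]_n) (r : R) :
  measurable (cball x r : set (borel_rV R n)).
Proof.
have [r0|r0] := leP 0 r; last first.
  rewrite (_ : cball x r = set0) //; apply/seteqP; split => // y.
  rewrite /cball /closed_ball_ /= => H.
  by have := le_lt_trans H r0; rewrite ltNge normr_ge0.
by rewrite cball_coord//;
    apply: (@measurable_box _ _ (fun i => ivl (x 0 i) r)) => i; exact: measurable_ivl.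
Qed.

(** An open set of R^n is a countable union of cubes with rational centre and radius
1 / (k + 1), and the preimage of a cube is a finite intersection. *)
Lemma measurable_fun_rV d (T : measurableType d) (R : realType) n
    (f : T -> borel_rV R n) :
  (forall i, measurable_fun setT (fun x => f x 0 i : measurableTypeR R)) ->
  measurable_fun setT f.
Proof.
move=> mf; apply: (@measurability _ _ T (borel_rV R n) setT f (@open 'rV[R]_n))
    => // _ [U oU <-]; rewrite setTI.
pose cube (qk : 'rV[rat]_n * nat) : set 'rV[R]_n :=
  [set y | forall i, `|ratr (qk.1 0 i) - y 0 i| < qk.2.+1%:R^-1].
have -> : U = \bigcup_qk (if `[< cube qk `<=` U >] then cube qk else set0).
  apply/seteqP; split => [y Uy|y [qk _]]; last by case: asboolP => // H; exact: H.
  have /nbhs_ballP[e /= e0 eU] : nbhs y U by exact: open_nbhs_nbhs.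
  (* Cubes of radius 1 / (k + 1) < e / 2 that contain y stay in the ball. *)
  pose k := Num.truncn (2 / e).
  have k0 : 0 < k.+1%:R^-1 :> R by rewrite invr_gt0.
  have ke : k.+1%:R^-1 < e / 2.
    by rewrite -invf_div ltf_pV2 ?posrE ?divr_gt0// truncnS_gt.
  have q_ i : {q : rat | `|ratr q - y 0 i| < k.+1%:R^-1}.
    apply: cid; have [|q] := @rat_in_itvoo R (y 0 i - k.+1%:R^-1) (y 0 i + k.+1%:R^-1).
      by rewrite ltrD2l (lt_trans _ k0)// oppr_lt0.
    by rewrite in_itv/= => H; exists q; rewrite ltr_distl.
  have cy : cube (\row_i sval (q_ i), k) y.
    by move=> i /=; rewrite mxE; exact: svalP (q_ i).
  exists (\row_i sval (q_ i), k) => //; case: asboolP => // -[]; move=> z cz.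
  apply: eU; rewrite -ball_normE /ball_ /=; apply/(rV_norm_ltP _ e0) => i.
  have := cy i; have := cz i; rewrite /= !mxE => H1 H2.
  have -> : y 0 i - z 0 i = (y 0 i - ratr (sval (q_ i))) + (ratr (sval (q_ i)) - z 0 i).
    by rewrite addrA subrK.
  apply: le_lt_trans (ler_normD _ _) _; rewrite distrC [ltRHS]splitr.
  by rewrite ltrD// ?(lt_trans H1 ke)// (lt_trans H2 ke).
rewrite preimage_bigcup; apply: countable_bigcupT_measurable => // qk.
case: asboolP => _; last by rewrite preimage_set0.
rewrite (_ : _ @^-1` _ =
  \bigcap_(i in [set: 'I_n]) ((fun x => f x 0 i : measurableTypeR R) @^-1`
    [set z : R | `|ratr (qk.1 0 i) - z| < qk.2.+1%:R^-1])); last first.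
  by apply/seteqP; split => y /= H i; [move=> _; exact: H|exact: H].
apply: fin_bigcap_measurable; first exact: finite_finset.
move=> i _; rewrite -[X in measurable X]setTI; apply: mf => //.
rewrite (_ : mkset _ = ball (ratr (qk.1 0 i) : R) qk.2.+1%:R^-1).
  exact: measurable_ball.
by rewrite -ball_normE.
Qed.

Lemma product_probability d1 d2 (T1 : measurableType d1) (T2 : measurableType d2)
    (R : realType) (P1 : probability T1 R) (P2 : probability T2 R) :
  exists P : probability (T1 * T2)%type R, forall A B, measurable A -> measurable B ->
    P (A `*` B) = (P1 A * P2 B)%E.
Proof.
pose m := (P1 \x P2)%E.
have mT : m setT = 1%E.
  transitivity (P1 setT * P2 setT)%E; last by rewrite !probability_setT mule1.
  by rewrite /m -setXTT product_measure1E.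
pose P : probability (T1 * T2)%type R :=
    HB.pack m (Measure_isProbability.Build _ _ _ m mT).
by exists P => A B mA mB; exact: product_measure1E.
Qed.

(** By induction on the dimension: the map that adds a first coordinate to a vector
sends the product of the first factor and of the product of the others to the
product sought. The masses are taken in R, where the product over n + 1 factors
splits without conditions. *)
Lemma product_rV (R : realType) n (nu : 'I_n -> probability (measurableTypeR R) R) :
  exists P : probability (borel_rV R n) R,
  forall A : 'I_n -> set (measurableTypeR R), (forall i, measurable (A i)) ->
    P (box A) = (\prod_(i < n) fine (nu i (A i)))%:E.
Proof.
elim: n nu => [|n ih] nu.
  pose z : borel_rV R 0 := (0 : 'rV[R]_0).
  pose D : probability (borel_rV R 0) R := dirac z.
  exists D => A mA.
  rewrite big_ord0; transitivity (D setT); last exact: probability_setT.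
  by congr (D _); apply/seteqP; split => // y _ [].
have [P HP] := ih (fun i => nu (lift ord0 i)).
have [PP HPP] := product_probability (nu ord0) P.
pose f (av : measurableTypeR R * borel_rV R n) : borel_rV R n.+1 :=
  \row_i (if unlift ord0 i is Some j then av.2 0 j else av.1).
have mf : measurable_fun setT f.
  apply: measurable_fun_rV => i; rewrite /f.
  rewrite (_ : (fun x => _) = (fun x : measurableTypeR R * borel_rV R n =>
    if unlift ord0 i is Some j then x.2 0 j else x.1)); last first.
    by apply/funext => x; rewrite mxE.
  case: (unlift ord0 i) => [j|]; last exact: measurable_fst.
  by apply: (measurableT_comp (measurable_coord j)); exact: measurable_snd.
have [Q HQ] := pushforward_probability PP mf.
exists Q => A mA; rewrite HQ; last exact: (measurable_box mA).
have -> : f @^-1` box A =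
    A ord0 `*` box (fun i : 'I_n => A (lift ord0 i)).
  apply/seteqP; split => [[a v] /= H|[a v] [/= H1 H2] i].
    split => [|i]; first by have := H ord0; rewrite /f mxE unlift_none.
    by have := H (lift ord0 i); rewrite /f mxE liftK.
  by rewrite /f mxE; case: unliftP => [j|] ->.
rewrite HPP//; last exact: (measurable_box (fun i => mA (lift ord0 i))).
rewrite (HP (fun i => A (lift ord0 i)))// big_ord_recl EFinM fineK//.
exact: fin_num_measure.
Qed.

(** * Inner regularity *)

Section regularity.
Context {R : realType} {n : nat}.
Variable P : probability (borel_rV R n) R.

(** Regular sets: approximated in measure by closed sets from inside and by open sets
from outside. Asking for both makes the notion stable under complement. *)
Definition squeezed (A : set 'rV[R]_n) : Prop :=
  forall e : R, 0 < e -> exists F U : set 'rV[R]_n,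
    [/\ closed F, open U, F `<=` A, A `<=` U &
        (P (U `\` F : set (borel_rV R n)) <= e%:E)%E].

Lemma measurable_gap (F U : set 'rV[R]_n) : closed F -> open U ->
  measurable (U `\` F : set (borel_rV R n)).
Proof.
by move=> cF oU; apply: measurableD;
  [exact: measurable_open_rV|exact: measurable_closed_rV].
Qed.

Lemma squeezed_setC A : squeezed A -> squeezed (~` A).
Proof.
move=> sA e e0; have [F [U [cF oU FA AU le]]] := sA e e0.
exists (~` U), (~` F); split.
- exact: open_closedC.
- exact: closed_openC.
- exact: subsetC.
- exact: subsetC.
by rewrite setDE setCK setIC -setDE.
Qed.

(** Continuity from above of the measure along the decreasing differences. *)
Lemma nondecreasing_gap (B : nat -> set (borel_rV R n)) e : 0 < e ->
  (forall k, measurable (B k)) -> (forall k, B k `<=` B k.+1) ->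
  exists k, (P (\bigcup_j B j `\` B k) <= e%:E)%E.
Proof.
move=> e0 mB BS.
have mU : measurable (\bigcup_j B j) by exact: bigcupT_measurable.
have BW : {homo B : i j / (i <= j)%N >-> (i <= j)%O}.
  apply: homo_leq; [by move=> X; exact: lexx|by move=> Y X Z; exact: le_trans|].
  by move=> k; apply/subsetPset.
have : P (\bigcup_j B j `\` B k) @[k --> \oo] --> 0%E.
  have -> : 0%E = P (\bigcap_k (\bigcup_j B j `\` B k)).
    rewrite (_ : \bigcap_k _ = set0) ?measure0//.
    apply/seteqP; split => // x H; have [[j _ Bj] _] := H 0%N I.
    by have [_] := H j I.
  apply: (@nonincreasing_cvg_mu _ _ _ P (fun k => \bigcup_j B j `\` B k)).
  - exact: le_lt_trans (probability_le1 _ (measurableD mU (mB _))) (ltry _).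
  - by move=> k; exact: measurableD.
  - by apply: bigcapT_measurable => k; exact: measurableD.
  - by move=> i j ij; apply/subsetPset; apply: setDS; exact/subsetPset/BW.
move=> /fine_cvgP[_ /cvgr0Pnorm_lt/(_ e e0)[k _ /(_ k (leqnn k)) /ltW H]].
exists k; rewrite -[X in (X <= _)%E]fineK; last first.
  exact: fin_num_measure _ (measurableD mU (mB k)).
by rewrite lee_fin; apply: le_trans H; exact: ler_norm.
Qed.

(** An open set is the increasing union of the closed sets of the points at distance at
least 1 / (k + 1) from its complement. *)
Lemma squeezed_open (U : set 'rV[R]_n) : open U -> squeezed U.
Proof.
move=> oU e e0.
pose F k := ~` (\bigcup_(y in ~` U) ball y (k.+1%:R^-1 : R)).
have cF k : closed (F k).
  by apply: open_closedC; apply: bigcup_open => y _; exact: ball_open.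
have FU k : F k `<=` U.
  move=> x Fx; apply: contrapT => Ux; apply: Fx; exists x => //.
  by apply: ballxx; rewrite invr_gt0.
have FS k : F k `<=` F k.+1.
  apply: subsetC => x [y Uy yx]; exists y => //; apply: le_ball yx.
  by rewrite lef_pV2 ?posrE// ler_nat.
have UE : \bigcup_k F k = U.
  apply/seteqP; split => [x [k _]|x Ux]; first exact: FU.
  have /nbhs_ballP[d /= d0 dU] : nbhs x U by exact: open_nbhs_nbhs.
  exists (Num.truncn d^-1) => // -[y Uy /ball_sym yx]; apply: Uy; apply: dU.
  apply: le_ball yx; apply: ltW.
  by rewrite -[ltRHS]invrK ltf_pV2 ?posrE ?invr_gt0// truncnS_gt.
have [k Hk] := @nondecreasing_gap F e e0 (fun k => measurable_closed_rV (cF k)) FS.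
exists (F k), U; split; [exact: cF|exact: oU|exact: FU|by []|].
by apply: le_trans Hk; rewrite UE.
Qed.

(** The errors e / 2^(i+2) add up to e / 2; the union of the closed sets is not closed,
but a finite subunion misses it by at most e / 2. *)
Lemma squeezed_bigcup (A : nat -> set 'rV[R]_n) :
  (forall k, squeezed (A k)) -> squeezed (\bigcup_k A k).
Proof.
move=> sA e e0; have e20 : 0 < e / 2 by rewrite divr_gt0.
have ek k : 0 < e / 2 / (2 ^ k.+1)%:R by rewrite divr_gt0// ltr0n expn_gt0.
have [F /choice[U FU]] := choice (fun k => sA k _ (ek k)).
have cF k : closed (F k) by have [] := FU k.
have oU k : open (U k) by have [] := FU k.
pose B k := \bigcup_(i in `I_k) F i.
have cB k : closed (B k) by apply: closed_bigcup => //; exact: finite_II.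
have BS k : B k `<=` B k.+1 by apply: bigcup_subset => i /= /ltnW.
have BE : \bigcup_k B k = \bigcup_k F k.
  apply/seteqP; split => x [k _]; first by move=> [i _ Fi]; exists i.
  by move=> Fk; exists k.+1 => //; exists k => /=.
have [k Hk] := @nondecreasing_gap B _ e20 (fun k => measurable_closed_rV (cB k)) BS.
have oUU : open (\bigcup_k U k) by apply: bigcup_open.
exists (B k), (\bigcup_k U k); split => //.
- by move=> x [i _ Fi]; exists i => //; have [_ _ + _ _] := FU i; apply.
- by move=> x [i _ Ai]; exists i => //; have [_ _ _ + _] := FU i; apply.
have mF : measurable (\bigcup_k F k : set (borel_rV R n)).
  by apply: bigcupT_measurable => i; exact: measurable_closed_rV.
have mU : measurable (\bigcup_k U k : set (borel_rV R n)) by exact: measurable_open_rV.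
have mB : measurable (B k : set (borel_rV R n)) by exact: measurable_closed_rV.
have m1 := measurableD mU mF; have m2 := measurableD mF mB.
apply: (@le_trans _ _ (P ((\bigcup_k U k `\` \bigcup_k F k)
    `|` (\bigcup_k F k `\` B k)))).
  apply: le_measure; rewrite ?inE; [exact: measurable_gap|exact: measurableU|].
  move=> x [Ux Bx]; have [Fx|Fx] := pselect ((\bigcup_k F k) x); last by left.
  by right.
apply: le_trans (measureU2 _ m1 m2) _.
rewrite (splitr e) EFinD; apply: leeD; last by rewrite -BE.
apply: (@le_trans _ _ (\sum_(0 <= i <oo) P (U i `\` F i))%E).
  apply: measure_sigma_subadditive => //; first by move=> i; exact: measurable_gap.
  move=> x [[i _ Ui] nF]; exists i => //; split => // Fi; apply: nF; by exists i.
apply: (@le_trans _ _ (\sum_(0 <= i <oo) (0 + (e / 2 / (2 ^ i.+1)%:R)%:E))%E).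
  by apply: lee_nneseries => // i _; rewrite add0e; have [] := FU i.
apply: le_trans (epsilon_trick _ _ (ltW e20)) _ => //.
by rewrite eseries0// add0e.
Qed.

(** Regular sets form a sigma-algebra that contains the open sets. *)
Lemma measurable_squeezed (A : set (borel_rV R n)) : measurable A -> squeezed A.
Proof.
apply: smallest_sub; last exact: squeezed_open.
split.
- by apply: squeezed_open; exact: open0.
- by move=> B sB; rewrite setTD; exact: squeezed_setC.
- exact: squeezed_bigcup.
Qed.

Lemma radon_of_compact_support (S : set 'rV[R]_n) :
  compact S -> P (S : set (borel_rV R n)) = 1%E -> radon P.
Proof.
move=> cS PS.
have clos (K : set 'rV[R]_n) : compact K -> closed K.
  by apply: compact_closed; exact: norm_hausdorff.
have mS : measurable (S : set (borel_rV R n)).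
  by apply: measurable_closed_rV; exact: clos.
split=> [K cK|A mA].
  apply: le_lt_trans (probability_le1 _ _) (ltry _).
  by apply: measurable_closed_rV; exact: clos.
apply/eqP; rewrite eq_le; apply/andP; split; last first.
  apply: ge_ereal_sup => _ [K [cK KA] <-]; apply: le_measure; rewrite ?inE//.
  by apply: measurable_closed_rV; exact: clos.
apply/lee_addgt0Pr => e e0.
have [F [U [cF oU FA AU le]]] := measurable_squeezed mA e0.
have cFS : compact (F `&` S).
  apply: (subclosed_compact _ cS); last exact: subIsetr.
  by apply: closedI => //; exact: clos.
have mFS : measurable (F `&` S : set (borel_rV R n)).
  by apply: measurable_closed_rV; exact: clos.
have mG := measurable_gap cF oU.
have PSC : P (~` S : set (borel_rV R n)) = 0%E.
  by rewrite probability_setC// PS subee.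
apply: (@le_trans _ _ (P ((F `&` S) `|` (U `\` F) `|` ~` S))).
  apply: le_measure; rewrite ?inE//.
    by apply: measurableU; [exact: measurableU|exact: measurableC].
  move=> x Ax; have [Sx|] := pselect (S x); last by right.
  left; have [Fx|Fx] := pselect (F x); first by left.
  by right; split => //; exact: AU.
apply: le_trans (measureU2 _ (measurableU _ _ mFS mG) (measurableC mS)) _.
rewrite [X in (_ + X <= _)%E]PSC adde0.
apply: le_trans (measureU2 _ mFS mG) _; apply: leeD => //.
by apply: ereal_sup_ubound; exists (F `&` S) => //; split => // x [Fx _]; exact: FA.
Qed.

End regularity.

(** * Measurability of the annulus set *)

Lemma cball_sub (R : realType) n (x y : 'rV[R]_n) (p q : R) :
  `|x - y| + p <= q -> cball y p `<=` cball x q.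
Proof.
move=> h z; rewrite /cball /closed_ball_ /= => yz.
have -> : x - z = (x - y) + (y - z) by rewrite addrA subrK.
by apply: le_trans (ler_normD _ _) _; lra.
Qed.

Lemma powR_cont (R : realType) (a r : R) : 0 < r ->
  (fun z => z `^ a) z @[z --> r] --> r `^ a.
Proof.
move=> r0; apply: (@differentiable_continuous _ _ _ r (fun z => z `^ a)).
by apply/derivable1_diffP; apply: derivable_powR; rewrite in_itv/= r0.
Qed.

Section annulus_measurable.
Context {R : realType} {n : nat}.
Variable mu : probability (borel_rV R n) R.

Definition ball_mass (x : 'rV[R]_n) (r : R) : R := fine (mu (cball x r)).

Lemma ball_massE x r : mu (cball x r) = (ball_mass x r)%:E.
Proof. by rewrite fineK//; apply: fin_num_measure; exact: measurable_cball. Qed.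

(** The mass of a closed ball is upper semicontinuous in the centre: the ball is the
intersection of the concentric balls of radii r + 1 / (k + 1), and these contain the
balls of radius r around all sufficiently close points. *)
Lemma ball_mass_lt_open (r c : R) : open [set x | ball_mass x r < c].
Proof.
rewrite openE => x /= xc.
pose B k := cball x (r + k.+1%:R^-1) : set (borel_rV R n).
have mB k : measurable (B k) by exact: measurable_cball.
have BI : \bigcap_k B k = cball x r.
  apply/seteqP; split => y.
    rewrite /B /cball /closed_ball_ /= => H; apply/ler_addgt0Pr => e e0.
    apply: le_trans (H (Num.truncn e^-1) I) _; rewrite lerD2l ltW//.
    by rewrite -[ltRHS]invrK ltf_pV2 ?posrE ?invr_gt0// truncnS_gt.
  rewrite /B /cball /closed_ball_ /= => H k _.
  by apply: le_trans H _; rewrite lerDl.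
have cvg : mu (B k) @[k --> \oo] --> mu (cball x r).
  rewrite -BI; apply: nonincreasing_cvg_mu => //.
  - exact: le_lt_trans (probability_le1 _ (mB _)) (ltry _).
  - by apply: bigcapT_measurable.
  move=> i j ij; apply/subsetPset => y; rewrite /B /cball /closed_ball_ /= => H.
  by apply: le_trans H _; rewrite lerD2l lef_pV2 ?posrE// ler_nat.
move: cvg; rewrite ball_massE => /fine_cvgP[_ /cvgr_lt/(_ c xc)].
move=> [k _ /(_ k (leqnn k)) /= Hk].
have k0 : 0 < k.+1%:R^-1 :> R by [].
apply/nbhs_ballP; exists k.+1%:R^-1 => //= y; rewrite -ball_normE /ball_ /= => xy.
apply: le_lt_trans Hk; apply: fine_le.
- by apply: fin_num_measure; exact: measurable_cball.
- by apply: fin_num_measure; exact: mB.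
apply: le_measure; rewrite ?inE; [exact: measurable_cball|exact: mB|].
by apply: cball_sub; rewrite addrC lerD2l ltW.
Qed.

Lemma measurable_ball_mass (r : R) :
  measurable_fun setT (fun x : borel_rV R n => ball_mass x r : measurableTypeR R).
Proof.
apply: (measurability (@RGenCInfty.G R)) => [|/= _ [_] [c] -> <-].
  exact: RGenCInfty.measurableE.
rewrite setTI (_ : _ @^-1` _ = ~` [set x | ball_mass x r < c]).
  by apply: measurableC; apply: measurable_open_rV; exact: ball_mass_lt_open.
by apply/seteqP; split => x /=; rewrite in_itv/= andbT leNgt; move/negP.
Qed.

Variables (delta eta : R).
Hypothesis delta1 : 1 < delta.
Hypothesis cont : forall (x : 'rV[R]_n) (r : R), 0 < r ->
  ball_mass x z @[z --> r] --> ball_mass x r.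

(** Nonnegative exactly when the annulus has a share at least eta of the mass of the
ball ([annulus_propE]). *)
Definition annulus_gap (x : 'rV[R]_n) (r : R) : R :=
  (1 - eta) * ball_mass x r - ball_mass x (r - r `^ delta).

Lemma annulus_propE x r :
  annulus_prop mu x r delta eta <-> 0 <= annulus_gap x r.
Proof.
have mc q := measurable_cball x q.
rewrite /annulus_prop /annulus measureD//; last first.
  exact: le_lt_trans (probability_le1 _ (mc _)) (ltry _).
rewrite setIidr; last first.
  by apply: cball_sub; rewrite subrr normr0 add0r gerBl powR_ge0.
rewrite [X in (eta%:E * X)%E](ball_massE x r) [X in (_ <= X - _)%E](ball_massE x r).
rewrite [X in (_ - X)%E](ball_massE x (r - r `^ delta))
    -EFinM -EFinB lee_fin /annulus_gap; split; lra.
Qed.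

Lemma shrink_gt0 (r : R) : 0 < r < 1 -> 0 < r - r `^ delta.
Proof.
move=> /andP[r0 r1]; rewrite subr_gt0.
have d1 : 0 < delta - 1 by rewrite subr_gt0.
rewrite -(mulr_powRB1 (ltW r0)) ?(lt_trans _ delta1)//.
rewrite gtr_pMr// -[ltRHS](_ : 1 `^ (delta - 1) = 1); last by rewrite powR1.
by apply: (@gt0_ltr_powR _ (delta - 1)); rewrite ?nnegrE ?(ltW r0).
Qed.

Lemma annulus_gap_cont x (r : R) : 0 < r < 1 ->
  annulus_gap x z @[z --> r] --> annulus_gap x r.
Proof.
move=> r01; have /andP[r0 r1] := r01.
apply: cvgB; first by apply: cvgM; [exact: cvg_cst|exact: cont].
have c1 : (z - z `^ delta) @[z --> r] --> r - r `^ delta.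
  by apply: cvgB; [exact: cvg_id|exact: powR_cont].
exact: (cvg_comp _ _ c1 (@cont x _ (shrink_gt0 r01))).
Qed.

Lemma measurable_annulus_gap r :
  measurable_fun setT (fun x : borel_rV R n => annulus_gap x r : measurableTypeR R).
Proof.
apply: measurable_funB; last exact: measurable_ball_mass.
by apply: measurable_funM => //; exact: measurable_ball_mass.
Qed.

(** Existence of a radius in terms of countably many radii. From right to left the gap
attains its maximum on [a,b], and this maximum is larger than every
- 1 / (m + 1). *)
Lemma annulus_gap_ge0P x (a b : R) : 0 < a -> a < b -> b < 1 ->
  (exists2 r, a <= r <= b & 0 <= annulus_gap x r) <->
  (forall m : nat, exists2 q : rat, a <= ratr q <= b &
     - m.+1%:R^-1 < annulus_gap x (ratr q)).
Proof.
move=> a0 ab b1; split=> [[r /andP[ar rb] r0] m|H].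
  have r01 : 0 < r < 1 by rewrite (lt_le_trans a0 ar) (le_lt_trans rb b1).
  have m0 : - m.+1%:R^-1 < annulus_gap x r.
    by apply: lt_le_trans r0; rewrite oppr_lt0.
  have /cvgr_gt/(_ _ m0) := @annulus_gap_cont x r r01.
  move=> /nbhs_ballP[e /= e0 He].
  have [|q] := @rat_in_itvoo R (Num.max a (r - e)) (Num.min b (r + e)).
    rewrite lt_min !gt_max ab /=; apply/andP; split; first lra.
    apply/andP; split; lra.
  rewrite in_itv/= lt_min gt_max => /andP[/andP[q1 q2] /andP[q3 q4]].
  exists q; first by rewrite !ltW.
  apply: He; rewrite -ball_normE /ball_ /= ltr_norml; lra.
have [|c] := @EVT_max R (annulus_gap x) a b (ltW ab).
  apply: continuous_in_subspaceT => z /set_mem /=; rewrite in_itv/= => /andP[az zb].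
  by apply: annulus_gap_cont; rewrite (lt_le_trans a0 az) (le_lt_trans zb b1).
rewrite in_itv/= => cab cmax; exists c => //; rewrite leNgt; apply/negP => c0.
(* A rank m for which - 1 / (m + 1) is above the negative maximum. *)
pose m := Num.truncn (- annulus_gap x c)^-1.
have [q qab] := H m; apply/negP; rewrite -leNgt.
have qab' : ratr q \in `[a, b] by rewrite in_itv.
apply: le_trans (cmax _ qab') _.
rewrite lerNr ltW// -[ltRHS]invrK ltf_pV2 ?posrE ?invr_gt0 ?oppr_gt0//.
exact: truncnS_gt.
Qed.

Lemma measurable_annulus_gap_ge0 (a b : R) : 0 < a -> a < b -> b < 1 ->
  measurable ([set x | exists2 r, a <= r <= b & 0 <= annulus_gap x r] :
    set (borel_rV R n)).
Proof.
move=> a0 ab b1.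
rewrite (_ : mkset _ = \bigcap_(m in [set: nat]) \bigcup_(q : rat)
   (if a <= ratr q <= b then
     [set x : borel_rV R n | - m.+1%:R^-1 < annulus_gap x (ratr q)] else set0));
         last first.
  apply/seteqP; split => x /=.
    move=> /(annulus_gap_ge0P _ a0 ab b1) H m _; have [q qab Hq] := H m.
    by exists q => //; rewrite qab.
  move=> H; apply/(annulus_gap_ge0P _ a0 ab b1) => m; have [q _] := H m I.
  by case: ifPn => // qab Hq; exists q.
apply: bigcapT_measurable => m; apply: countable_bigcupT_measurable => // q.
case: ifPn => // _.
rewrite (_ : mkset _ = (fun x => annulus_gap x (ratr q)) @^-1`
  `](- m.+1%:R^-1), +oo[%classic); last first.
  by apply/seteqP; split => x /=; rewrite in_itv/= andbT.
rewrite -[X in measurable X]setTI; apply: measurable_annulus_gap => //.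
Qed.

(** A sequence of radii that tends to 0 exists if and only if there is a radius below
each b_k = 1 / (k + 2); the interval ]0, b_k] is the union of the segments
[b_k / (m + 2), b_k], where [measurable_annulus_gap_ge0] applies. *)
Lemma measurable_annulus_set :
  measurable (annulus_set mu delta eta : set (borel_rV R n)).
Proof.
pose b (k : nat) : R := k.+2%:R^-1.
pose a (k m : nat) : R := b k / m.+2%:R.
have b0 k : 0 < b k by rewrite /b invr_gt0.
have b1 k : b k < 1 by rewrite /b invf_lt1// ltr1n.
have a0 k m : 0 < a k m by rewrite divr_gt0.
have ab k m : a k m < b k by rewrite /a ltr_pdivrMr// ltr_pMr// ltr1n.
rewrite (_ : annulus_set _ _ _ = \bigcap_k \bigcup_m
  [set x : borel_rV R n | exists2 r, a k m <= r <= b k & 0 <= annulus_gap x r]).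
  apply: bigcapT_measurable => k; apply: bigcupT_measurable => m.
  exact: measurable_annulus_gap_ge0.
apply/seteqP; split => x.
  move=> [r [r01 /cvgr0Pnorm_lt rcvg rP]] k _.
  have [j _ /(_ j (leqnn j)) /= rj] := rcvg _ (b0 k).
  have /andP[rj0 rj1] := r01 j.
  exists (Num.truncn (b k / r j)) => //; exists (r j); last exact/annulus_propE.
  apply/andP; split; last by rewrite ltW// (le_lt_trans _ rj)// ler_norm.
  rewrite /a ler_pdivrMr// mulrC -ler_pdivrMr// ltW//.
  by apply: lt_trans (truncnS_gt _) _; rewrite ltr_nat.
move=> H; have {}H k : exists r, 0 < r <= b k /\ 0 <= annulus_gap x r.
  have [m _ [r /andP[ar rb] r0]] := H k I.
  by exists r; split => //; rewrite rb (lt_le_trans (a0 k m)).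
have [r Hr] := choice H; exists r; split.
- move=> k; have [/andP[-> rb] _] := Hr k; exact: le_lt_trans (b1 k).
- apply: (@squeeze_cvgr _ _ _ _ (fun=> 0) (fun k => k.+1%:R^-1)).
  + apply: nearW => k; have [/andP[r0 rb] _] := Hr k; rewrite ltW//=.
    by apply: le_trans rb _; rewrite /b lef_pV2 ?posrE// ler_nat.
  + exact: cvg_cst.
  exact: cvg_harmonic.
by move=> k; apply/annulus_propE; have [] := Hr k.
Qed.

End annulus_measurable.

(** * Dimensions and continuity of the masses of balls *)

Lemma powRD_gt0 (R : realType) (x r s : R) : 0 < x -> x `^ (r + s) = x `^ r * x `^ s.
Proof. by move=> x0; rewrite powRD// (gt_eqF x0) implybT. Qed.

Lemma powR_small (R : realType) (c e : R) : 0 < c -> 0 < e ->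
  exists2 r, 0 < r & forall u, 0 < u < r -> u `^ e < c.
Proof.
move=> c0 e0; exists (c `^ e^-1) => [|u /andP[u0 uc]]; first by rewrite powR_gt0.
have -> : c = (c `^ e^-1) `^ e by rewrite -powRrM mulVf ?gt_eqF// powRr1// ltW.
by apply: (@gt0_ltr_powR _ e) => //; rewrite nnegrE ?powR_ge0 ?(ltW u0).
Qed.

Lemma cvg0_small (R : realType) (u : nat -> R) (e : R) : 
  u k @[k --> \oo] --> (0 : R) -> 0 < e -> exists k, u k < e.
Proof.
move=> /cvgr0Pnorm_lt/[apply] -[k _ /(_ k (leqnn k)) /= H].
by exists k; apply: le_lt_trans H; exact: ler_norm.
Qed.

Section dimensions.
Context {R : realType} {n : nat}.
Variable mu : probability (borel_rV R n) R.
Variables (S : set (borel_rV R n)) (r0 c C : R).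
Hypotheses (mS : measurable S) (S1 : mu S = 1%E).
Hypotheses (r00 : 0 < r0) (c0 : 0 < c) (C0 : 0 < C).

(** A property that holds almost everywhere has a witness in every set of full
measure; one point is enough to refute an exponent. *)
Lemma ae_meets_full (Q : borel_rV R n -> Prop) : {ae mu, forall x, Q x} ->
  exists2 x, S x & Q x.
Proof.
move=> [N [mN N0 QN]]; apply: contrapT => no.
have : (mu S <= mu N)%E.
  apply: le_measure; rewrite ?inE// => x Sx; apply: QN => Qx; apply: no; by exists x.
by rewrite S1 N0 leNgt lte_fin ltr01.
Qed.

Lemma ae_full (Q : borel_rV R n -> Prop) : (forall x, S x -> Q x) ->
  {ae mu, forall x, Q x}.
Proof.
move=> SQ; exists (~` S); split; first exact: measurableC.
  by rewrite probability_setC// S1 subee.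
by move=> x nQ Sx; apply: nQ; exact: SQ.
Qed.

(** The upper bound on the masses at all scales shows that every exponent below a is
admissible, and a lower bound along one sequence of scales excludes those above a.
The constants disappear because the exponents are compared with a strict
inequality. *)
Lemma lower_dim_eq (a : R) (u : nat -> R) : 0 < a ->
  (forall k, 0 < u k) -> u k @[k --> \oo] --> (0 : R) ->
  (forall x r, 0 < r < r0 -> (mu (cball x r) <= (C * r `^ a)%:E)%E) ->
  (forall x k, S x -> u k < r0 -> ((c * u k `^ a)%:E <= mu (cball x (u k)))%E) ->
  lower_dim mu = a%:E.
Proof.
move=> a0 u0 ucvg up lo; apply/eqP; rewrite eq_le; apply/andP; split.
  apply: ge_ereal_sup => _ [al [al0 ae_al] <-]; rewrite lee_fin leNgt;
      apply/negP => aal.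
  have [x Sx [rx rx0 Hx]] := ae_meets_full ae_al.
  have e0 : 0 < al - a by rewrite subr_gt0.
  have [r1 r10 Hr1] := powR_small c0 e0.
  have m0 : 0 < Num.min (Num.min rx r0) r1 by rewrite !lt_min rx0 r00.
  have [k] := cvg0_small ucvg m0.
  rewrite !lt_min => /andP[/andP[k1 k2] k3].
  have H1 := Hx (u k); rewrite u0 k1 in H1.
  have := le_trans (lo x k Sx k2) (H1 isT); rewrite lee_fin; apply/negP; rewrite -ltNge.
  have -> : u k `^ al = u k `^ (al - a) * u k `^ a.
    by rewrite -powRD_gt0// subrK.
  by rewrite ltr_pM2r ?powR_gt0//; apply: Hr1; rewrite u0.
apply/lee_addgt0Pr => e e0.
(* The exponent a - e1 has to be nonnegative. *)
pose e1 := Num.min e (a / 2).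
have e10 : 0 < e1 by rewrite lt_min e0 divr_gt0.
have e1e : e1 <= e by rewrite ge_min lexx.
have e1a : e1 <= a / 2 by rewrite ge_min lexx orbT.
have Ci : 0 < C^-1 by rewrite invr_gt0.
have [r1 r10 Hr1] := powR_small Ci e10.
apply: (@le_trans _ _ ((a - e1)%:E + e%:E)%E).
  by rewrite -EFinD lee_fin; lra.
apply: leeD => //; apply: ereal_sup_ubound; exists (a - e1) => //; split; first lra.
apply: aeW => x; exists (Num.min r0 r1); first by rewrite lt_min r00.
move=> r; rewrite lt_min => /andP[r_0 /andP[rr0 rr1]].
apply: le_trans (up x r _) _; first by rewrite r_0.
rewrite lee_fin; have -> : r `^ a = r `^ e1 * r `^ (a - e1).
  by rewrite -powRD_gt0// subrKC.
rewrite mulrA ler_piMl ?powR_ge0// mulrC -ler_pdivlMr// mul1r ltW//.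
by apply: Hr1; rewrite r_0.
Qed.

Lemma upper_dim_eq (b : R) (v : nat -> R) : 0 < b ->
  (forall k, 0 < v k) -> v k @[k --> \oo] --> (0 : R) ->
  (forall x r, S x -> 0 < r < r0 -> ((c * r `^ b)%:E <= mu (cball x r))%E) ->
  (forall x k, v k < r0 -> (mu (cball x (v k)) <= (C * v k `^ b)%:E)%E) ->
  upper_dim mu = b%:E.
Proof.
move=> b0 v0 vcvg lo up; apply/eqP; rewrite eq_le; apply/andP; split; last first.
  apply: le_ereal_inf_tmp => _ [be [be0 ae_be] <-]; rewrite lee_fin leNgt;
      apply/negP => beb.
  have [x Sx [rx rx0 Hx]] := ae_meets_full ae_be.
  have e0 : 0 < b - be by rewrite subr_gt0.
  have Ci : 0 < C^-1 by rewrite invr_gt0.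
  have [r1 r10 Hr1] := powR_small Ci e0.
  have m0 : 0 < Num.min (Num.min rx r0) r1 by rewrite !lt_min rx0 r00.
  have [k] := cvg0_small vcvg m0.
  rewrite !lt_min => /andP[/andP[k1 k2] k3].
  have H1 := Hx (v k); rewrite v0 k1 in H1.
  have := le_trans (H1 isT) (up x k k2); rewrite lee_fin; apply/negP; rewrite -ltNge.
  have -> : v k `^ b = v k `^ (b - be) * v k `^ be.
    by rewrite -powRD_gt0// subrK.
  rewrite mulrA gtr_pMl ?powR_gt0// mulrC -ltr_pdivlMr// mul1r.
  by apply: Hr1; rewrite v0.
apply/lee_addgt0Pr => e e0.
have [r1 r10 Hr1] := powR_small c0 e0.
apply: ereal_inf_lbound; exists (b + e); last by rewrite EFinD.
split; first lra.
apply: ae_full => x Sx; exists (Num.min r0 r1); first by rewrite lt_min r00.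
move=> r; rewrite lt_min => /andP[r_0 /andP[rr0 rr1]].
apply: le_trans (lo x r Sx _); last by rewrite r_0.
rewrite lee_fin powRD_gt0// mulrC ler_pM2r ?powR_gt0// ltW//.
by apply: Hr1; rewrite r_0.
Qed.

End dimensions.

(** Absence of atoms in a uniform version, which gives continuity of the mass of a ball
with respect to its radius. *)
Definition diffuse (R : realType) (nu : probability (measurableTypeR R) R) :=
  forall e : R, 0 < e -> exists2 p : R, 0 < p & forall x, (nu (ivl x p) <= e%:E)%E.

Lemma diffuse_of_powR (R : realType) (nu : probability (measurableTypeR R) R)
    (C s : R) :
  0 < C -> 0 < s -> (forall x p, 0 < p < 1 -> (nu (ivl x p) <= (C * p `^ s)%:E)%E) ->
  diffuse nu.
Proof.
move=> C0 s0 H e e0; have eC : 0 < e / C by rewrite divr_gt0.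
have [r r0 Hr] := powR_small eC s0.
have p0 : 0 < Num.min r 1 / 2 by rewrite divr_gt0// lt_min r0 ltr01.
have p1 : Num.min r 1 / 2 < Num.min r 1
    by rewrite ltr_pdivrMr// ltr_pMr ?lt_min ?r0 ?ltr01// ltr1n.
exists (Num.min r 1 / 2) => // x.
move: p1; rewrite lt_min => /andP[pr p1].
apply: le_trans (H x _ _) _; first by rewrite p0.
by rewrite lee_fin mulrC -ler_pdivlMr// ltW// Hr// p0 pr.
Qed.

(** Two concentric intervals differ by points that are close to one of the two ends of
either interval. *)
Lemma ivl_shell (R : realType) (nu : probability (measurableTypeR R) R)
    (y q r p e : R) :
  `|q - r| <= p -> (forall x, (nu (ivl x p) <= e%:E)%E) ->
  fine (nu (ivl y q)) <= fine (nu (ivl y r)) + 2 * e.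
Proof.
move=> qr He; have mI x z : measurable (ivl x z) by exact: measurable_ivl.
rewrite -lee_fin EFinD !fineK; [|exact: fin_num_measure..].
apply: (@le_trans _ _ (nu (ivl y r `|` (ivl (y + r) p `|` ivl (y - r) p)))).
  apply: le_measure; rewrite ?inE//; first by do 2?apply: measurableU.
  move=> z; rewrite /setU /= !ivlE; move: qr; rewrite ler_norml => qr zy.
  have [H|H] := leP z (y + r); last by right; left; lra.
  have [H'|H'] := leP (y - r) z; last by right; right; lra.
  by left; lra.
apply: le_trans (measureU2 _ _ _) _ => //; first exact: measurableU.
apply: leeD => //; apply: le_trans (measureU2 _ _ _) _ => //.
have -> : 2 * e = e + e by ring.
by rewrite EFinD; apply: leeD; exact: He.
Qed.

Lemma diffuse_cont (R : realType) (nu : probability (measurableTypeR R) R) (y r : R) :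
  diffuse nu -> fine (nu (ivl y z)) @[z --> r] --> fine (nu (ivl y r)).
Proof.
move=> dnu; apply/cvgrPdist_le => e e0.
have e2 : 0 < e / 2 by rewrite divr_gt0.
have [p p0 Hp] := dnu _ e2.
apply/nbhs_ballP; exists p => //= z /ltW rz.
have H1 := ivl_shell y rz Hp; rewrite distrC in rz; have H2 := ivl_shell y rz Hp.
rewrite ler_norml; apply/andP; split; lra.
Qed.

Lemma product_ball_cont (R : realType) n (nu : 'I_n ->
    probability (measurableTypeR R) R)
    (P : probability (borel_rV R n) R) :
  (forall A : 'I_n -> set (measurableTypeR R), (forall i, measurable (A i)) ->
    P (box A) = (\prod_(i < n) fine (nu i (A i)))%:E) ->
  (forall i, diffuse (nu i)) ->
  forall (x : 'rV[R]_n) (r : R), 0 < r ->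
  ball_mass P x z @[z --> r] --> ball_mass P x r.
Proof.
move=> HP dnu x r r0.
have E z : 0 <= z -> ball_mass P x z = \prod_(i < n) fine (nu i (ivl (x 0 i) z)).
  move=> z0; rewrite /ball_mass cball_coord// HP// => i; exact: measurable_ivl.
rewrite E ?(ltW r0)//.
apply: cvg_trans (_ : (fun z => \prod_(i < n) fine (nu i (ivl (x 0 i) z)))
    @ r --> _); last first.
  apply: cvg_big => [|i _]; first exact: mul_continuous.
  exact: diffuse_cont.
apply: near_eq_cvg; apply/nbhs_ballP; exists r => //= z rz.
by rewrite E//; move: rz; rewrite /ball_ /= ltr_norml; lra.
Qed.

(** * Product with the uniform law on a cube *)

Lemma unif01_ivl_le (R : realType) (x p : R) : 0 <= p ->
  (unif01 R (ivl x p) <= (2 * p)%:E)%E.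
Proof.
by move=> p0; apply: (@unif01_le _ _ x).
Qed.

Lemma unif01_ivl_ge (R : realType) (x p : R) : 0 <= x <= 1 -> 0 <= p <= 2^-1 ->
  (p%:E <= unif01 R (ivl x p))%E.
Proof.
move=> /andP[x0 x1] /andP[p0 p2]; have mI := measurable_ivl x p.
have [h|h] := leP x 2^-1.
  have {1}-> : p = (x + p) - x by rewrite addrC addKr.
  apply: unif01_ge => //; first by lra.
  by move=> y; rewrite ivlE; lra.
have {1}-> : p = x - (x - p) by rewrite subKr.
apply: unif01_ge => //; first by lra.
by move=> y; rewrite ivlE; lra.
Qed.

Lemma unif01_diffuse (R : realType) : diffuse (unif01 R).
Proof.
move=> e e0; exists (e / 2) => [|x]; first by rewrite divr_gt0.
apply: le_trans (unif01_ivl_le _ _) _; first by rewrite divr_ge0// ltW.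
by rewrite mulrC divfK.
Qed.

Lemma unif01_seg (R : realType) : unif01 R `[0, 1]%classic = 1%E.
Proof.
apply/eqP; rewrite eq_le probability_le1//=.
have := @unif01_ge R `[0, 1]%classic 0 1; rewrite subr0; apply => // y.
by rewrite /= in_itv/= => /andP[/ltW-> /ltW->].
Qed.

Section lift.
Context {R : realType} {k : nat}.
Variable nu : probability (measurableTypeR R) R.

Definition factor (i : 'I_k.+1) : probability (measurableTypeR R) R :=
  if unlift ord0 i is Some _ then unif01 R else nu.

(** The factors of the box A x B x ... x B. *)
Definition slab (A B : set (measurableTypeR R)) (i : 'I_k.+1) :
    set (measurableTypeR R) :=
  if unlift ord0 i is Some _ then B else A.

Lemma factor0 : factor ord0 = nu.
Proof. by rewrite /factor unlift_none. Qed.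

Lemma factor_lift i : factor (lift ord0 i) = unif01 R.
Proof. by rewrite /factor liftK. Qed.

Lemma factor_diffuse i : diffuse nu -> diffuse (factor i).
Proof.
by rewrite /factor; case: unlift => // _ _; exact: unif01_diffuse.
Qed.

Lemma slabP A B (y : 'rV[R]_k.+1) :
  box (slab A B) y <-> A (y 0 ord0) /\ forall i, B (y 0 (lift ord0 i)).
Proof.
split=> [H|[H1 H2] i].
  split=> [|i]; first by have := H ord0; rewrite /slab unlift_none.
  by have := H (lift ord0 i); rewrite /slab liftK.
by rewrite /slab; case: unliftP => [j|] ->.
Qed.

Lemma measurable_slab A B i : measurable A -> measurable B -> measurable (slab A B i).
Proof. by rewrite /slab; case: unlift. Qed.

Variable P : probability (borel_rV R k.+1) R.
Hypothesis HP : forall A : 'I_k.+1 -> set (measurableTypeR R),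
  (forall i, measurable (A i)) ->
  P (box A) = (\prod_(i < k.+1) fine (factor i (A i)))%:E.

Lemma mass_slab A B : measurable A -> measurable B ->
  P (box (slab A B)) = (fine (nu A) * fine (unif01 R B) ^+ k)%:E.
Proof.
move=> mA mB; rewrite HP; last by move=> i; exact: measurable_slab.
rewrite big_ord_recl factor0 /slab unlift_none; congr (_ * _)%:E.
rewrite (eq_bigr (fun=> fine (unif01 R B))); last first.
  by move=> i _; rewrite factor_lift liftK.
by rewrite prodr_const card_ord.
Qed.

(** The mass of a cube that is due to the uniform coordinates; it lies between r ^ k and
(2 r) ^ k when the centre is in the unit cube and r <= 1/2. *)
Definition side_mass (x : 'rV[R]_k.+1) (r : R) : R :=
  \prod_(i < k) fine (unif01 R (ivl (x 0 (lift ord0 i)) r)).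

Lemma side_mass_ge0 x r : 0 <= side_mass x r.
Proof. by apply: prodr_ge0 => i _; apply: fine_ge0; exact: measure_ge0. Qed.

Lemma side_mass_le (x : 'rV[R]_k.+1) (r : R) : 0 <= r -> side_mass x r <= (2 * r) ^+ k.
Proof.
move=> r0; rewrite -[X in _ <= _ ^+ X](card_ord k) -prodr_const.
apply: ler_prod => i _; rewrite fine_ge0 ?measure_ge0//=.
rewrite -lee_fin fineK; first exact: unif01_ivl_le.
by apply: fin_num_measure; exact: measurable_ivl.
Qed.

Lemma side_mass_ge (x : 'rV[R]_k.+1) (r : R) :
  (forall i, 0 <= x 0 (lift ord0 i) <= 1) -> 0 <= r <= 2^-1 ->
  r ^+ k <= side_mass x r.
Proof.
move=> x01 r0; rewrite -[X in _ ^+ X <= _](card_ord k) -prodr_const.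
apply: ler_prod => i _; case/andP: (r0) => -> _ /=.
rewrite -lee_fin fineK; first exact: unif01_ivl_ge.
by apply: fin_num_measure; exact: measurable_ivl.
Qed.

Lemma mass_cball (x : 'rV[R]_k.+1) (r : R) : 0 <= r ->
  P (cball x r) = (fine (nu (ivl (x 0%R ord0) r)) * side_mass x r)%:E.
Proof.
move=> r0; rewrite cball_coord// HP; last by move=> i; exact: measurable_ivl.
rewrite big_ord_recl factor0; congr (_ * _)%:E.
by apply: eq_bigr => i _; rewrite factor_lift.
Qed.

Lemma mass_cball_le (x : 'rV[R]_k.+1) (r : R) (s C : R) : 0 < r ->
    (nu (ivl (x 0%R ord0) r) <= (C * r `^ s)%:E)%E ->
  (P (cball x r) <= (C * 2 ^+ k * r `^ (k%:R + s))%:E)%E.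
Proof.
move=> r0 H; rewrite mass_cball ?(ltW r0)// lee_fin.
rewrite powRD_gt0// powR_mulrn ?(ltW r0)//.
have -> : C * 2 ^+ k * (r ^+ k * r `^ s) = C * r `^ s * (2 * r) ^+ k.
  by rewrite exprMn; ring.
apply: ler_pM; rewrite ?fine_ge0 ?measure_ge0 ?side_mass_ge0 ?side_mass_le ?(ltW r0)//.
rewrite -lee_fin fineK//; apply: fin_num_measure; exact: measurable_ivl.
Qed.

Lemma mass_cball_ge (x : 'rV[R]_k.+1) (r : R) (s c : R) : 0 <= c -> 0 < r <= 2^-1 ->
  (forall i, 0 <= x 0 (lift ord0 i) <= 1) ->
  ((c * r `^ s)%:E <= nu (ivl (x 0%R ord0) r))%E ->
  ((c * r `^ (k%:R + s))%:E <= P (cball x r))%E.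
Proof.
move=> c0 /andP[r0 r2] x01 H; rewrite mass_cball ?(ltW r0)// lee_fin.
rewrite powRD_gt0// powR_mulrn ?(ltW r0)//.
have -> : c * (r ^+ k * r `^ s) = c * r `^ s * r ^+ k by ring.
apply: ler_pM; rewrite ?mulr_ge0 ?powR_ge0 ?exprn_ge0 ?(ltW r0)//.
  rewrite -lee_fin fineK//; apply: fin_num_measure; exact: measurable_ivl.
by apply: side_mass_ge => //; rewrite (ltW r0).
Qed.

(** The annulus contains the box of the points of the cube whose first coordinate lies
in the one-dimensional annulus. In this box and in the cube the other coordinates
contribute the same factor [side_mass x r]. *)
Lemma annulus_prop_of_first_factor (x : 'rV[R]_k.+1) (r : R) (delta eta : R)
    : 1 < delta -> 0 < r < 1 ->
  (eta%:E * nu (ivl (x 0%R ord0) r) <=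
    nu (ivl (x 0%R ord0) r `\` ivl (x 0%R ord0) (r - r `^ delta)%R))%E ->
  annulus_prop P x r delta eta.
Proof.
move=> d1 r01 H; have /andP[r0 r1] := r01; have rr := shrink_gt0 d1 r01.
have mI y q : measurable (ivl y q) by exact: measurable_ivl.
set x0 := x 0 ord0 in H.
pose A (i : 'I_k.+1) := if unlift ord0 i is Some _ then ivl (x 0 i) r
  else ivl x0 r `\` ivl x0 (r - r `^ delta).
have mA i : measurable (A i) by rewrite /A; case: unlift => [_|] //; exact: measurableD.
rewrite /annulus_prop; apply: (@le_trans _ _ (P (box A))); last first.
  apply: le_measure; rewrite ?inE; first exact: measurable_box.
    by apply: measurableD; exact: measurable_cball.
  move=> y yA; split.
    rewrite cball_coord ?(ltW r0)// => i; have := yA i; rewrite /A.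
    by case: unliftP => [j _ //|->] [].
  rewrite cball_coord ?(ltW rr)// => /(_ ord0).
  by have := yA ord0; rewrite /A unlift_none => -[].
have -> : P (box A) = (fine (nu (ivl x0 r `\` ivl x0 (r - r `^ delta)))
    * side_mass x r)%:E.
  rewrite HP// big_ord_recl factor0 /A unlift_none; congr (_ * _)%:E.
  by apply: eq_bigr => i _; rewrite factor_lift liftK.
have mD : measurable (ivl x0 r `\` ivl x0 (r - r `^ delta)) by exact: measurableD.
apply: (@le_trans _ _ (eta%:E * (fine (nu (ivl x0 r)) * side_mass x r)%:E)%E).
  by rewrite -mass_cball// ltW.
rewrite -EFinM lee_fin mulrA; apply: ler_wpM2r; first exact: side_mass_ge0.
by rewrite -lee_fin EFinM !fineK//; apply: fin_num_measure.
Qed.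

End lift.

Theorem theorem1p4 (R : realType) (d : nat) (hd : (1 <= d)%N) (dl du eta : R)
    (hdl : d%:R - 1 < dl) (hdlu : dl < du) (hdu : du < d%:R)
    (heta : 0 < eta < 1) :
  let delta : R := (du - (d%:R - 1)) / (dl - (d%:R - 1)) in
  exists mu : probability (borel_rV R d) R,
    [/\ radon mu,
        lower_dim mu = dl%:E,
        upper_dim mu = du%:E,
        measurable (annulus_set mu delta eta : set (borel_rV R d)) &
        mu (annulus_set mu delta eta) = 1%E].
Proof.
case: d hd hdl hdu => // k _; rewrite -natr1 addrK => hdl hdu delta.
have [eta0 eta1] := andP heta.
pose s := dl - k%:R; pose t := du - k%:R.
have s0 : 0 < s by rewrite subr_gt0.
have st : s < t by rewrite ltrD2r.
have t1 : t < 1 by rewrite ltrBlDr addrC.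
have t0 : 0 < t by exact: lt_trans st.
have k0 : 0 <= k%:R :> R by [].
have delta1 : 1 < delta by rewrite ltr_pdivlMr// mul1r.
have [nu [K [G [c [C [u [v [[c0 C0 uv0 ucvg vcvg] [cK K1] [up up'] [lo lo'] [mG G1 HG]]]]]]]]] :=
  two_scale_measure s0 st t1 eta1.
have [P HP] := product_rV (@factor R k nu).
have dlE : k%:R + s = dl by rewrite subrKC.
have duE : k%:R + t = du by rewrite subrKC.
have dnu : diffuse nu := diffuse_of_powR C0 s0 up.
have cont := product_ball_cont HP (fun i => factor_diffuse i dnu).
have mE := measurable_annulus_set eta delta1 cont.
have cseg : compact (`[0, 1]%classic : set R) by exact: segment_compact.
have mseg : measurable (`[0, 1]%classic : set (measurableTypeR R))
    by exact: measurable_itv.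
pose S : set (borel_rV R k.+1) := box (slab K `[0, 1]%classic).
have cS : compact (S : set 'rV[R]_k.+1).
  apply: (@rV_compact R k.+1 (slab K `[0, 1]%classic)) => i.
  by rewrite /slab; case: unlift.
have mK : measurable (K : set (measurableTypeR R)).
  by apply: closed_measurable; apply: compact_closed cK; exact: norm_hausdorff.
have mS : measurable S by apply: measurable_box => i; exact: measurable_slab.
have S1 : P S = 1%E by rewrite (mass_slab HP)// K1 unif01_seg /= expr1n mul1r.
have Sside x : S x -> forall i, 0 <= x 0 (lift ord0 i) <= 1.
  by move=> /slabP[_ H] i; have := H i; rewrite /= in_itv.
have r00 : 0 < 2^-1 :> R by rewrite invr_gt0.
have C20 : 0 < C * 2 ^+ k by rewrite mulr_gt0// exprn_gt0.
exists P; split => //.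
- exact: radon_of_compact_support cS S1.
- apply: (@lower_dim_eq _ _ P S 2^-1 c (C * 2 ^+ k) mS S1 r00 c0 C20 dl u) => //.
  + by rewrite -dlE; lra.
  + by move=> j; have [] := uv0 j.
  + move=> x r /andP[r0 r2]; rewrite -dlE; apply: (mass_cball_le HP) => //.
    by apply: up; rewrite r0 (lt_trans r2)// invf_lt1// ltr1n.
  move=> x j Sx uj; rewrite -dlE; have [uj0 _] := uv0 j.
  apply: (mass_cball_ge HP) => //; first exact: ltW.
  + by rewrite uj0 ltW.
  + exact: Sside.
  by apply: lo'; have [] := (slabP _ _ x).1 Sx.
- apply: (@upper_dim_eq _ _ P S 2^-1 c (C * 2 ^+ k) mS S1 r00 c0 C20 du v) => //.
  + by rewrite -duE; lra.
  + by move=> j; have [] := uv0 j.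
  + move=> x r Sx /andP[r0 r2]; rewrite -duE; apply: (mass_cball_ge HP) => //;
      first exact: ltW.
    * by rewrite r0 ltW.
    * exact: Sside.
    apply: lo; first by have [] := (slabP _ _ x).1 Sx.
    by rewrite r0 (lt_trans r2)// invf_lt1// ltr1n.
  move=> x j vj; rewrite -duE; apply: (mass_cball_le HP) => //; have [_ //] := uv0 j.
apply/eqP; rewrite eq_le probability_le1//=.
have mT : measurable (setT : set (measurableTypeR R)) by [].
(* The radii that work for the first coordinate of a point work for the point. *)
have <- : P (box (slab G setT)) = 1%E.
  by rewrite (mass_slab HP)// G1 probability_setT /= expr1n mul1r.
apply: le_measure; rewrite ?inE//.
  by apply: measurable_box => i; exact: measurable_slab.
move=> x /slabP[Gx _].
have H (j : nat) : exists p, 0 < p < j.+2%:R^-1 /\ annulus_prop P x p delta eta.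
  have j0 : 0 < j.+2%:R^-1 :> R by rewrite invr_gt0.
  have [p [p0 pj Hp]] := HG _ _ Gx j0.
  exists p; split; first by rewrite p0.
  apply: (annulus_prop_of_first_factor HP) => //;
      rewrite p0 (lt_trans pj)// invf_lt1// ltr1n//.
have [r Hr] := choice H; exists r; split.
- move=> j; have [/andP[-> rj] _] := Hr j; apply: lt_trans rj _.
  by rewrite invf_lt1// ltr1n.
- apply: (@squeeze_cvgr _ _ _ _ (fun=> 0) (fun k => k.+1%:R^-1)).
  + apply: nearW => j; have [/andP[r0 rb] _] := Hr j; rewrite ltW//=.
    by apply: le_trans (ltW rb) _; rewrite lef_pV2 ?posrE// ler_nat.
  + exact: cvg_cst.
  exact: cvg_harmonic.
by move=> j; have [] := Hr j.
Qed.
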